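(* There exists a $(3,3)$-periodic function $Q:\mathbb{Z}^2\to\mathbb{R}$ such that $\sigma(\Delta_{\mathrm{sqn}}+\lambda Q)$ has exactly two connected components for all sufficiently small $\lambda>0$.
   Context: EHM lattice (square lattice with next-nearest neighbor interactions): the vertex set is $\mathbb{Z}^2$, and $\bm{n}\sim\bm{n}'$ iff $\|\bm{n}-\bm{n}'\|_\infty=1$. The Laplacian $\Delta_{\mathrm{sqn}}$ is the bounded self-adjoint operator on $\ell^2(\mathbb{Z}^2)$ given by $[\Delta_{\mathrm{sqn}}\psi]_{\bm{n}}=\sum_{\bm{n}'\sim\bm{n}}\psi_{\bm{n}'}$ (the adjacency operator). A bounded function $Q:\mathbb{Z}^2\to\mathbb{R}$ acts on $\ell^2(\mathbb{Z}^2)$ by multiplication. $Q$ is $(p_1,p_2)$-periodic if $Q(n+p_1,m)=Q(n,m+p_2)=Q(n,m)$ for all $(n,m)\in\mathbb{Z}^2$. $\sigma$ denotes spectrum. *)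

(* Defs.v *)
From HB Require Import structures.
From mathcomp Require Import all_boot all_order all_algebra.
From mathcomp Require Import all_classical all_reals all_analysis.
From mathcomp Require Import complex.
From mathcomp Require Import ring lra zify.

Set Implicit Arguments.
Unset Strict Implicit.
Unset Printing Implicit Defensive.

Import Order.TTheory GRing.Theory Num.Theory.
Import numFieldNormedType.Exports.
Import ComplexField.Normc.

Local Open Scope classical_set_scope.
Local Open Scope complex_scope.
Local Open Scope ring_scope.

(* The squared l^2 norm, possibly infinite. *)
Definition ell2_mass (R : realType) (I : choiceType) (f : I -> R[i]) : \bar R :=
  (\esum_(n in [set: I]) (normc (f n) ^+ 2)%:E)%E.

Definition square_summable (R : realType) (I : choiceType) :
    {pred I -> R[i]} :=
  [pred f | `[< (ell2_mass f < +oo)%E >]].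

Section SquareSummable.
Variables (R : realType) (I : choiceType).
Implicit Types (f g : I -> R[i]) (c : R[i]).
Local Notation mass := (@ell2_mass R I).
Local Notation l2 := (@square_summable R I).

Lemma square_summableP f : reflect (mass f < +oo)%E (f \in l2).
Proof. exact: asboolP. Qed.

Lemma ell2_mass_ge0 f : (0 <= mass f)%E.
Proof. by apply: esum_ge0 => n _; rewrite lee_fin sqr_ge0. Qed.

Lemma ell2_mass_fin f : f \in l2 -> mass f \is a fin_num.
Proof.
by move=> /square_summableP fl; rewrite ge0_fin_numE// ell2_mass_ge0.
Qed.

Lemma ell2_mass0 : mass 0 = 0%E.
Proof. by apply: esum1 => n _; rewrite normc0 expr0n. Qed.

Lemma ell2_mass_term f n : ((normc (f n) ^+ 2)%:E <= mass f)%E.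
Proof.
apply: esum_ge; exists [set n]; first by split => //; exact: finite_set1.
by rewrite fsbig_set1.
Qed.

Lemma ell2_mass_le f g (M : R) : (forall n, normc (g n) <= M * normc (f n)) ->
  (mass g <= (M ^+ 2)%:E * mass f)%E.
Proof.
move=> gf; rewrite ge_ereal_sup//= => _ [X [finX _] <-].
apply: (@le_trans _ _ (\sum_(n \in X) ((M ^+ 2)%:E * (normc (f n) ^+ 2)%:E)%E)%R).
  apply: lee_fsum => // n _; rewrite -EFinM lee_fin -exprMn.
  by rewrite lerXn2r ?nnegrE// ?(le_trans _ (gf n))//; case: (g n) => *; exact: sqrtr_ge0.
rewrite -ge0_mule_fsumr//; last by move=> n; rewrite lee_fin sqr_ge0.
rewrite lee_wpmul2l ?lee_fin ?sqr_ge0//.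
by apply: esum_ge; exists X.
Qed.

Lemma ell2_massZ c f : mass (c *: f) = ((normc c ^+ 2)%:E * mass f)%E.
Proof.
apply/eqP; rewrite eq_le; apply/andP; split.
  by apply: ell2_mass_le => n; rewrite normcM.
have [->|c0] := eqVneq c 0.
  by rewrite normc0 expr0n/= mul0e ell2_mass_ge0.
have nc0 : normc c != 0 by apply: contra_neq c0; exact: eq0_normc.
have /(lee_wpmul2l (_ : 0 <= (normc c ^+ 2)%:E)%E) :
    (mass f <= (((normc c)^-1) ^+ 2)%:E * mass (c *: f))%E.
  by apply: ell2_mass_le => n; rewrite normcM mulrA mulVf// mul1r.
rewrite muleA -EFinM -exprMn mulfV// expr1n mul1e; apply.
by rewrite lee_fin sqr_ge0.
Qed.

(* Summing |a + b|^2 <= (1 + t) |a|^2 + (1 + t^-1) |b|^2; optimising over t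
   gives the triangle inequality. *)
Lemma ell2_massD f g (t : R) : 0 < t ->
  (mass (f + g)%R <= (1 + t)%:E * mass f + (1 + t^-1)%:E * mass g)%E.
Proof.
move=> t0; rewrite ge_ereal_sup//= => _ [X [finX _] <-].
apply: (@le_trans _ _ (\sum_(n \in X) (((1 + t)%:E * (normc (f n) ^+ 2)%:E)
   + ((1 + t^-1)%:E * (normc (g n) ^+ 2)%:E))%E)%R).
  apply: lee_fsum => // n _; rewrite -!EFinM -EFinD lee_fin.
  have h := le_normcD (f n) (g n).
  have n0 (z : R[i]) : 0 <= normc z by case: z => *; exact: sqrtr_ge0.
  have := n0 (f n); have := n0 (g n); have := n0 (f n + g n).
  move: h; set a := normc (f n); set b := normc (g n).
  rewrite -[normc ((f + g) n)]/(normc (f n + g n)); set c := normc _.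
  move=> cab c0 b0 a0.
  apply: (@le_trans _ _ ((a + b) ^+ 2)).
    by rewrite lerXn2r// nnegrE// addr_ge0.
  rewrite -subr_ge0.
  have -> : (1 + t) * a ^+ 2 + (1 + t^-1) * b ^+ 2 - (a + b) ^+ 2
          = t^-1 * (t * a - b) ^+ 2 by field; exact: lt0r_neq0.
  by rewrite mulr_ge0 ?sqr_ge0// invr_ge0 ltW.
have t1 : 0 <= 1 + t^-1 by rewrite addr_ge0// invr_ge0 ltW.
have t2 : 0 <= 1 + t by rewrite addr_ge0// ltW.
rewrite fsbig_split//= -!ge0_mule_fsumr//; [|by move=> n; rewrite lee_fin sqr_ge0..].
by apply: leeD; rewrite lee_wpmul2l ?lee_fin//; apply: esum_ge; exists X.
Qed.

Lemma square_summable_submod : submod_closed l2.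
Proof.
split; first by apply/square_summableP; rewrite ell2_mass0.
move=> c f g fl gl; apply/square_summableP.
have cf : c *: f \in l2.
  apply/square_summableP; rewrite ell2_massZ.
  by rewrite lte_mul_pinfty ?lee_fin ?sqr_ge0//; exact/square_summableP.
apply: (le_lt_trans (ell2_massD _ _ (@ltr01 R))).
rewrite lte_add_pinfty// lte_mul_pinfty ?lee_fin ?addr_ge0 ?invr_ge0//;
  exact/square_summableP.
Qed.

HB.instance Definition _ := GRing.isSubmodClosed.Build _ _ l2
  square_summable_submod.

End SquareSummable.

Section Ell2.
Variables (R : realType) (I : choiceType).

Record ell2 := Ell2 {
  ell2_fun :> I -> R[i];
  ell2_funP : ell2_fun \in @square_summable R I
}.

HB.instance Definition _ := [isSub for ell2_fun].
HB.instance Definition _ := [Choice of ell2 by <:].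
HB.instance Definition _ := [SubChoice_isSubLmodule of ell2 by <:].

(* The norm has values in the scalar field R[i], embedded via _%:C. *)
Definition ell2_norm (psi : ell2) : R[i] :=
  (Num.sqrt (fine (ell2_mass psi)))%:C.

Lemma ell2_normD (x y : ell2) : ell2_norm (x + y) <= ell2_norm x + ell2_norm y.
Proof.
rewrite /ell2_norm -rmorphD/= lecR.
have mE (z : ell2) : ell2_mass z = (fine (ell2_mass z))%:E.
  by rewrite fineK// ell2_mass_fin// ell2_funP.
have m0 (z : ell2) : 0 <= fine (ell2_mass z) by rewrite fine_ge0// ell2_mass_ge0.
pose s (z : ell2) : R := Num.sqrt (fine (ell2_mass z)).
have s2 (z : ell2) : fine (ell2_mass z) = s z ^+ 2 by rewrite /s sqr_sqrtr.
rewrite -/(s (x + y)) -/(s x) -/(s y).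
have h (t : R) : 0 < t ->
    s (x + y) ^+ 2 <= (1 + t) * s x ^+ 2 + (1 + t^-1) * s y ^+ 2.
  move=> t0; rewrite -!s2 -lee_fin EFinD !EFinM -!mE.
  exact: ell2_massD.
have s0 z : s z = 0 -> z = 0.
  move=> z0; apply/val_inj/funext => n /=.
  have := ell2_mass_term z n; rewrite mE s2 z0 expr0n lee_fin => hz.
  by apply: eq0_normc; apply/eqP; rewrite -sqrf_eq0 eq_le hz sqr_ge0.
have s00 : s 0 = 0 by rewrite /s [X in fine X]ell2_mass0 sqrtr0.
have [/s0->|xN0] := eqVneq (s x) 0; first by rewrite add0r s00 add0r.
have [/s0->|yN0] := eqVneq (s y) 0; first by rewrite addr0 s00 addr0.
have s_ge0 z : 0 <= s z by exact: sqrtr_ge0.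
have xp : 0 < s x by rewrite lt0r xN0 s_ge0.
have yp : 0 < s y by rewrite lt0r yN0 s_ge0.
have := h (s y / s x) (divr_gt0 yp xp).
have -> : (1 + s y / s x) * s x ^+ 2 + (1 + (s y / s x)^-1) * s y ^+ 2
        = (s x + s y) ^+ 2 by field; rewrite xN0 yN0.
by rewrite ler_pXn2r// nnegrE ?addr_ge0.
Qed.

Lemma ell2_normZ (c : R[i]) (x : ell2) : ell2_norm (c *: x) = `|c| * ell2_norm x.
Proof.
rewrite /ell2_norm -[`|c|]/((normc c)%:C) -rmorphM/=; congr (_ %:C).
rewrite ell2_massZ fineM ?ell2_mass_fin ?ell2_funP//=.
rewrite sqrtrM ?sqr_ge0// sqrtr_sqr ger0_norm//.
by case: c => *; exact: sqrtr_ge0.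
Qed.

Lemma ell2_norm0_eq0 (x : ell2) : ell2_norm x = 0 -> x = 0.
Proof.
move=> /eqP; rewrite /ell2_norm -(rmorph0 (real_complex R)).
rewrite (inj_eq (@complexI R)) sqrtr_eq0 => x0; apply/val_inj/funext => n /=.
have := ell2_mass_term x n.
rewrite -[ell2_mass x]fineK ?ell2_mass_fin ?ell2_funP// lee_fin => hz.
apply: eq0_normc; apply/eqP; rewrite -sqrf_eq0 eq_le sqr_ge0 andbT.
exact: le_trans hz x0.
Qed.

HB.instance Definition _ := Lmodule_isNormed.Build R[i] ell2
  ell2_normD ell2_normZ ell2_norm0_eq0.

End Ell2.

(* A is meant to be a bounded linear operator; the inverse B of A - z is asked
   to be everywhere defined, linear and bounded (for linear maps, continuous).
   K^o is K with its norm topology. *)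
Definition resolvent_set (K : numFieldType) (E : normedModType K)
    (A : E -> E) : set K^o :=
  [set z | exists B : {linear E -> E}, [/\ continuous B,
     cancel (fun x => A x - z *: x) B & cancel B (fun x => A x - z *: x)]].

Definition spectrum (K : numFieldType) (E : normedModType K)
    (A : E -> E) : set K^o := ~` resolvent_set A.

Definition connected_components (T : topologicalType) (A : set T) :
    set (set T) :=
  connected_component A @` A.

(* n ~ m iff the sup-norm distance of n and m is 1. *)
Definition ehm_adj (n m : int * int) : bool :=
  Num.max `|n.1 - m.1| `|n.2 - m.2| == 1.

Definition ehm_offsets : seq (int * int) :=
  [:: (1, 0); (-1, 0); (0, 1); (0, -1); (1, 1); (1, -1); (-1, 1); (-1, -1)].

Lemma ehm_adjE n :
  [set m | ehm_adj n m] = [set` [seq n + d | d <- ehm_offsets]].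
Proof.
apply/seteqP; split => [m nm|m /mapP[d + ->]].
  apply/mapP; exists (m - n); last by rewrite addrC subrK.
  move: n m nm => [n1 n2] [m1 m2]; rewrite /= /ehm_adj /=.
  by rewrite -[(m1, m2) - _]/(m1 - n1, m2 - n2) !inE !xpair_eqE; lia.
rewrite !inE /= /ehm_adj; case: n d => n1 n2 [d1 d2].
rewrite -[(n1, n2) + _]/(n1 + d1, n2 + d2) !xpair_eqE /=; lia.
Qed.

Lemma ehm_offsets_uniq n : uniq [seq n + d | d <- ehm_offsets].
Proof. by rewrite map_inj_uniq//; exact: addrI. Qed.

Section EHM.
Variable R : realType.
Local Notation H := (ell2 R (int * int)%type).

Definition ehm_adjacency (f : int * int -> R[i]) (n : int * int) : R[i] :=
  \sum_(m \in [set m | ehm_adj n m]) f m.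

Lemma ehm_adjacencyE f n :
  ehm_adjacency f n = \sum_(d <- ehm_offsets) f (n + d).
Proof.
rewrite /ehm_adjacency ehm_adjE -fsbig_seq ?ehm_offsets_uniq//.
by rewrite big_map.
Qed.

Lemma square_summable_shift (f : int * int -> R[i]) d :
  f \in @square_summable R _ -> (fun n => f (n + d)) \in @square_summable R _.
Proof.
move=> /square_summableP fl; apply/square_summableP.
rewrite /ell2_mass -(@reindex_esum _ _ _ setT setT (fun n => n + d)
  (fun n => (normc (f n) ^+ 2)%:E))//.
split => [x _ //|x y _ _ /addIr//|x _].
by exists (x - d) => //; rewrite subrK.
Qed.

Lemma ehm_adjacency_ell2 (psi : H) :
  ehm_adjacency psi \in @square_summable R _.
Proof.
have -> : ehm_adjacency psi =
    \sum_(d <- ehm_offsets) (fun n => psi (n + d)).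
  by apply/funext => n; rewrite ehm_adjacencyE fct_sumE.
by apply: rpred_sum => d _; exact/square_summable_shift/ell2_funP.
Qed.

Definition ehm_laplacian (psi : H) : H := Ell2 (ehm_adjacency_ell2 psi).

(* The default value 0 is only used when Q psi is not square summable, which
   never happens for bounded Q: see potentialE and periodic2_bounded. *)
Definition potential (Q : int * int -> R) (psi : H) : H :=
  insubd 0 (fun n => (Q n)%:C * psi n).

Lemma potentialE (Q : int * int -> R) (psi : H) n :
  (exists M, forall n, `|Q n| <= M) -> potential Q psi n = (Q n)%:C * psi n.
Proof.
move=> [M QM]; rewrite /potential val_insubd ifT//.
apply/square_summableP.
apply: (@le_lt_trans _ _ ((M ^+ 2)%:E * ell2_mass psi)%E).
  apply: ell2_mass_le => m; rewrite normcM ler_wpM2r//.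
    by case: (psi m) => *; exact: sqrtr_ge0.
  by rewrite /= expr0n/= addr0 sqrtr_sqr.
rewrite lte_mul_pinfty ?lee_fin ?sqr_ge0//.
exact/square_summableP/ell2_funP.
Qed.

Definition periodic2 (p1 p2 : nat) (Q : int * int -> R) : Prop :=
  forall n m : int, Q (n + p1%:Z, m) = Q (n, m) /\ Q (n, m + p2%:Z) = Q (n, m).

Lemma periodic2_bounded p1 p2 Q : (0 < p1)%N -> (0 < p2)%N ->
  periodic2 p1 p2 Q -> exists M, forall n, `|Q n| <= M.
Proof.
move=> p1_gt0 p2_gt0 perQ.
have perl (k : nat) n m : Q (n + k%:Z * p1%:Z, m) = Q (n, m).
  elim: k => [|k IHk]; first by rewrite mul0r addr0.
  by rewrite -IHk -[RHS](perQ _ _).1; congr (Q (_, _)); lia.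
have perr (k : nat) n m : Q (n, m + k%:Z * p2%:Z) = Q (n, m).
  elim: k => [|k IHk]; first by rewrite mul0r addr0.
  by rewrite -IHk -[RHS](perQ _ _).2; congr (Q (_, _)); lia.
have perlz (k : int) n m : Q (n + k * p1%:Z, m) = Q (n, m).
  case: k => k; first exact: perl.
  by rewrite -(perl k.+1) NegzE; congr (Q (_, _)); lia.
have perrz (k : int) n m : Q (n, m + k * p2%:Z) = Q (n, m).
  case: k => k; first exact: perr.
  by rewrite -(perr k.+1) NegzE; congr (Q (_, _)); lia.
exists (\sum_(i < p1) \sum_(j < p2) `|Q (i%:Z, j%:Z)|) => -[n m].
rewrite (divz_eq n p1%:Z) (divz_eq m p2%:Z) [_ + (n %% _)%Z]addrC.
rewrite [_ + (m %% _)%Z]addrC perlz perrz.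
have := modz_ge0 n (_ : p1%:Z != 0); have := ltz_mod n (_ : p1%:Z != 0).
have := modz_ge0 m (_ : p2%:Z != 0); have := ltz_mod m (_ : p2%:Z != 0).
case: (n %% _)%Z => i; case: (m %% _)%Z => j; try by lia.
move=> jp _ ip _.
have ip1 : (i < p1)%N by lia.
have jp2 : (j < p2)%N by lia.
rewrite (bigD1 (Ordinal ip1))//= (bigD1 (Ordinal jp2))//= -addrA lerDl.
by rewrite addr_ge0// sumr_ge0// => *; rewrite ?sumr_ge0.
Qed.

End EHM.

(* Main.v *)
(* Take Q(n, m) = eps n * eps m with eps = -1 on the multiples of 3 and eps = 1
   elsewhere, and write H + 1 = A (x) A + l eps (x) eps with
   A = 1 + shift + shift^-1.  By Floquet theory the spectrum of H + 1 is the
   union over quasi-momenta of the spectra of 9 x 9 Hermitian matrices.  At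
   mu = 0, the operator N = eps A on a period satisfies N^3 = N^2 + s with
   s = 2 - z^3 - z^-3 >= 0, and a kernel vector would be a joint eigenvector of
   two commuting such operators with product -l; the resultant of these
   equations is positive for 0 < l <= 4/9, so 0 is a gap.
   No other gap opens.  If mu is not in the spectrum, the index of the Floquet
   matrix minus mu does not depend on the quasi-momentum, while comparing the
   momenta (1, 1), (1, -1), (-1, -1), where A (x) A is explicit, shows that it
   does when mu separates two points of the spectrum of the same sign.
   The spectrum of the operator is identified with that of the matrices by a
   Neumann series for the normal equation, contracting by Parseval's identity
   for the discrete Fourier transform, and by Bloch waves damped by
   r^(|n| + |m|) as approximate eigenfunctions. *)

Require Import Defs.
From HB Require Import structures.
From mathcomp Require Import all_boot all_order all_algebra.
From mathcomp Require Import all_classical all_reals all_analysis.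
From mathcomp Require Import complex.
From mathcomp Require Import ring lra zify.
From mathcomp Require Import sesquilinear spectral.

Set Implicit Arguments.
Unset Strict Implicit.
Unset Printing Implicit Defensive.

Import Order.TTheory GRing.Theory Num.Theory.
Import numFieldNormedType.Exports.
Import ComplexField.Normc.

Local Open Scope classical_set_scope.
Local Open Scope complex_scope.
Local Open Scope ring_scope.
Local Open Scope sesquilinear_scope.

(** * Inertia of Hermitian matrices *)

(** For [l = 0] the spectrum of A (x) A is the single interval [-3, 9]. Its symbol (1 + 2 cos x)(1 +
    2 cos y) vanishes on the whole lines x = +-2 pi / 3 and y = +-2 pi / 3, so the gap at 0 has to
    open along all of them at once, including the crossings, where the 9 x 9 matrix has an
    eight-dimensional kernel. The product form of the potential is what makes this tractable: after
    multiplication by eps on both sides, each variable enters only through its own cubic, and the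
    determinant becomes an explicit polynomial in [l], [s t] and [s + t]. The index bounds come from
    two matrices. With J the all-ones matrix, [hop 1] is J, with eigenvalues 3, 0, 0, and [hop (-1)]
    is 2 - J, with eigenvalues 2, 2, -1. So A (x) A has eigenvalues 9 (once) and 0 (8 times) at (1,
    1); 6 (twice), -3 (once) and 0 (6 times) at (1, -1); 4 (4 times), 1 (once) and -2 (4 times) at
    (-1, -1). The potential moves each of them by at most [l]. The signature in the gap is therefore
    (5, 4), and every other level separating spectrum of one sign meets two momenta whose indices
    add up to more than 9. *)

Section QuadraticForms.
Variables (C : numClosedFieldType) (n : nat).
Implicit Types (M N U W : 'M[C]_n) (v w : 'rV[C]_n).

Definition sqnorm v : C := \sum_i `|v 0 i| ^+ 2.
Definition qform M v : C := (v *m M *m v ^t*) 0 0.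

Lemma qformE M v : qform M v = \sum_i (v *m M) 0 i * (v 0 i)^*.
Proof. by rewrite /qform mxE; apply: eq_bigr => i _; rewrite !mxE. Qed.

Lemma sqnorm_ge0 v : 0 <= sqnorm v.
Proof. by apply: sumr_ge0 => i _; rewrite exprn_ge0. Qed.

Lemma sqnorm_eq0 v : (sqnorm v == 0) = (v == 0).
Proof.
rewrite psumr_eq0; last by move=> i _; rewrite exprn_ge0.
apply/allP/eqP => [v0|-> i _]; last by rewrite mxE normr0 expr0n eqxx implybT.
apply/rowP => i; have := v0 i (mem_index_enum _).
by rewrite mxE /= expf_eq0 normr_eq0 => /eqP.
Qed.

Lemma sqnorm_gt0 v : (0 < sqnorm v) = (v != 0).
Proof. by rewrite lt0r sqnorm_ge0 andbT sqnorm_eq0. Qed.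

Lemma qform_scalar c v : qform c%:M v = c * sqnorm v.
Proof.
rewrite qformE /sqnorm mulr_sumr; apply: eq_bigr => i _.
by rewrite mul_mx_scalar mxE -mulrA normCK.
Qed.

Lemma qformD M N v : qform (M + N) v = qform M v + qform N v.
Proof. by rewrite /qform mulmxDr mulmxDl mxE. Qed.

Lemma qformN M v : qform (- M) v = - qform M v.
Proof. by rewrite /qform mulmxN mulNmx mxE. Qed.

Lemma qformB M N v : qform (M - N) v = qform M v - qform N v.
Proof. by rewrite qformD qformN. Qed.

Lemma qform_herm_real M v : M ^t* = M -> qform M v \is Num.real.
Proof.
move=> Mh; apply/CrealP; rewrite /qform.
have -> : (((v *m M *m v ^t*) 0 0)^* = ((v *m M *m v ^t*) ^t*) 0 0) by rewrite !mxE.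
by rewrite !trmx_mul !map_mxM Mh trmxCK mulmxA.
Qed.

(* [|v_i v_j| <= (|v_i|^2 + |v_j|^2) / 2] *)
Lemma qform_small M (e : C) v : (forall i j, `|M i j| <= e) ->
  `|qform M v| <= n%:R * e * sqnorm v.
Proof.
move=> Me; rewrite qformE; apply: le_trans (ler_norm_sum _ _ _) _.
pose a i := `|v 0 i|.
apply: (@le_trans _ _ (\sum_i \sum_j (e * ((a i ^+ 2 + a j ^+ 2) / 2)))).
  apply: ler_sum => i _; rewrite normrM norm_conjC mxE.
  apply: le_trans (_ : \sum_j `|v 0 j * M j i| * `|v 0 i| <= _).
    by rewrite -mulr_suml ler_wpM2r// ler_norm_sum.
  apply: ler_sum => j _; rewrite normrM -/(a i) -/(a j) mulrAC mulrC.
  have a0 k : 0 <= a k by rewrite normr_ge0.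
  have e0 : 0 <= e by rewrite (le_trans _ (Me i i)).
  apply: ler_pM => //; first by rewrite mulr_ge0.
  have ra k : a k \is Num.real by rewrite ger0_real.
  rewrite ler_pdivlMr ?ltr0n// -subr_ge0 [leRHS](_ : _ = (a i - a j) ^+ 2); last ring.
  by rewrite real_exprn_even_ge0// rpredB.
rewrite -subr_ge0 le_eqVlt; apply/orP; left; rewrite eq_sym subr_eq0 eq_sym; apply/eqP.
transitivity (\sum_i (n%:R * (e / 2) * a i ^+ 2) + \sum_j (n%:R * (e / 2) * a j ^+ 2)); last first.
  by rewrite -!mulr_sumr -[sqnorm v]/(\sum_i a i ^+ 2); field.
rewrite -big_split /=.
transitivity (\sum_i (\sum_(j < n) (e / 2 * a i ^+ 2) + \sum_j (e / 2 * a j ^+ 2))).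
  by apply: eq_bigr => i _; rewrite -big_split /=; apply: eq_bigr => j _; field.
rewrite big_split /= [X in _ + X]exchange_big -big_split /= !big_split /=.
congr (_ + _); apply: eq_bigr => i _; rewrite sumr_const card_ord -mulr_natl; ring.
Qed.

Lemma sqnorm_mulmx M v : sqnorm (v *m M) = qform (M *m M ^t*) v.
Proof.
rewrite /qform /sqnorm mulmxA -mulmxA mxE; apply: eq_bigr => i _.
by rewrite normCK -map_mxM -trmx_mul !mxE.
Qed.

Lemma sqnorm_mul_small M (e : C) v : (forall i j, `|M i j| <= e) ->
  sqnorm (v *m M) <= (n%:R * e) ^+ 2 * sqnorm v.
Proof.
move=> Me; rewrite -[leLHS]ger0_norm ?sqnorm_ge0// sqnorm_mulmx.
have -> : (n%:R * e) ^+ 2 = n%:R * (n%:R * e ^+ 2) by ring.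
apply: qform_small => i j; rewrite mxE; apply: le_trans (ler_norm_sum _ _ _) _.
apply: le_trans (_ : \sum_(k < n) e ^+ 2 <= _).
  apply: ler_sum => k _; rewrite !mxE normrM norm_conjC expr2.
  by apply: ler_pM.
by rewrite sumr_const card_ord mulr_natl.
Qed.

Lemma sqnormD v w : sqnorm (v + w) <= 2 * sqnorm v + 2 * sqnorm w.
Proof.
rewrite /sqnorm !mulr_sumr -big_split /=; apply: ler_sum => i _; rewrite mxE.
apply: le_trans (_ : (`|v 0 i| + `|w 0 i|) ^+ 2 <= _).
  by rewrite ler_pXn2r ?nnegrE ?addr_ge0// ler_normD.
rewrite -subr_ge0 [leRHS](_ : _ = (`|v 0 i| - `|w 0 i|) ^+ 2); last ring.
by rewrite real_exprn_even_ge0// rpredB ?normr_real.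
Qed.

(* The positive index of inertia of [M] is at least [k]. *)
Definition pos_ge (k : nat) M :=
  exists2 U : 'M[C]_n, (k <= \rank U)%N &
  exists2 e : C, 0 < e & forall v, (v <= U)%MS -> e * sqnorm v <= qform M v.

Lemma capmx_neq0 U W : (n < \rank U + \rank W)%N ->
  exists2 v : 'rV[C]_n, v != 0 & (v <= U)%MS && (v <= W)%MS.
Proof.
move=> rUW; have r0 : (U :&: W)%MS != 0.
  rewrite -mxrank_eq0 -lt0n.
  have := mxrank_sum_cap U W; have := rank_leq_col (U + W)%MS; lia.
by have [v] := rowV0Pn r0; rewrite sub_capmx => ? ?; exists v.
Qed.

(** If the dimensions added up to more than [n], the two subspaces would share a nonzero vector on
    which the form has both signs. *)
Lemma pos_ge_le k M : pos_ge k M -> forall l, pos_ge l (- M) -> (k + l <= n)%N.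
Proof.
move=> [U rU [e e0 Ue]] l [W rW [d d0 Wd]]; rewrite leqNgt; apply/negP => kl.
have [|v v0 /andP[vU vW]] := @capmx_neq0 U W; first lia.
have := lerD (Ue _ vU) (Wd _ vW).
by rewrite qformN subrr -mulrDl lt_geF// pmulr_rgt0 ?addr_gt0// sqnorm_gt0 v0.
Qed.

Lemma qformDl M v w : M ^t* = M -> w *m M = 0 -> qform M (v + w) = qform M v.
Proof.
move=> Mh wM; rewrite /qform mulmxDl wM addr0 linearD /= map_mxD mulmxDr mxE.
rewrite -[X in _ + X](_ : 0 = _) ?addr0// -mulmxA -Mh -map_mxM -trmx_mul wM.
by rewrite trmx0 map_mx0 mulmx0 mxE.
Qed.

(** A kernel vector [x] lies outside the positive subspace [U], and the form stays nonnegative on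
    [U + x]. Intersecting this larger space with the negative one gains a dimension, hence the
    strict inequality. *)
Lemma pos_ge_ker_lt k M : pos_ge k M -> forall l, pos_ge l (- M) ->
  M ^t* = M -> M \notin unitmx -> (k + l < n)%N.
Proof.
move=> [U rU [e e0 Ue]] l [W rW [d d0 Wd]] Mh Mu; rewrite ltnNge; apply/negP => kl.
have [x x0 xM] : exists2 x : 'rV_n, x != 0 & x *m M = 0.
  move: Mu; rewrite -row_free_unit -kermx_eq0 => /rowV0Pn[x /sub_kermxP].
  by exists x.
have xU : ~~ (x <= U)%MS.
  apply/negP => /Ue; rewrite /qform xM mul0mx mxE lt_geF//.
  by rewrite pmulr_rgt0// sqnorm_gt0 x0.
have rUx : (\rank U < \rank (U + x)%MS)%N.
  by rewrite rank_ltmx// ltmxE addsmxSl addsmx_sub submx_refl.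
have [|v v0] := @capmx_neq0 (U + x)%MS W; first lia.
move=> /andP[/sub_addsmxP[[a b] vE] vW].
have := lerD (Ue _ (submxMl a U)) (Wd _ vW); rewrite qformN.
rewrite vE qformDl//; last by rewrite -mulmxA xM mulmx0.
rewrite subrr => h.
have : d * sqnorm v <= 0.
  by apply: le_trans h; rewrite vE lerDr mulr_ge0 ?sqnorm_ge0// ltW.
by rewrite lt_geF// pmulr_rgt0// sqnorm_gt0 v0.
Qed.

Lemma exists_lower_bound (d : 'I_n -> C) :
  exists2 e : C, 0 < e & forall i, d i != 0 -> e <= `|d i|.
Proof.
pose K := 1 + \sum_i `|d i|^-1.
have K0 : 0 < K.
  by rewrite ltr_pwDl// sumr_ge0// => i _; rewrite invr_ge0.
exists K^-1; first by rewrite invr_gt0.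
move=> i di; rewrite invf_ple ?posrE ?normr_gt0//.
by rewrite /K (bigD1 i)//= addrCA lerDl addr_ge0// sumr_ge0.
Qed.

(** The signature of an invertible [M] is (p, n - p), so k > p means n - p >= n + 1 - k. This turns
    the failure of [pos_ge k] into an open condition too. *)
Lemma pos_geVneg k M : M ^t* = M -> M \in unitmx ->
  pos_ge k M \/ pos_ge (n.+1 - k)%N (- M).
Proof.
move=> Mh Mu; set P := spectralmx M; set d := spectral_diag M.
have MH : M \is hermsymmx by apply/is_hermitianmxP; rewrite expr0 scale1r Mh.
have Pu : P \is unitarymx := spectral_unitarymx M.
have PU : P \in unitmx := unitarymx_unit Pu.
have ME : M = P ^t* *m diag_mx d *m P.
  by rewrite -invmx_unitary//; exact/orthomx_spectralP/hermitian_normalmx.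
have dr i : d 0 i \is Num.real by apply/mxOverP/hermitian_spectral_diag_real.
have d0 i : d 0 i != 0.
  move: Mu; rewrite ME -invmx_unitary// !unitmx_mul unitmx_inv PU andbT /=.
  by rewrite unitmxE det_diag unitfE => /prodf_neq0 ->.
have [e e0 de] := exists_lower_bound (fun i => d 0 i).
have PPt : P *m P ^t* = 1%:M by apply/unitarymxP.
have sqP y : sqnorm (y *m P) = sqnorm y.
  by rewrite sqnorm_mulmx PPt (qform_scalar 1) mul1r.
have qP y : qform M (y *m P) = \sum_i d 0 i * `|y 0 i| ^+ 2.
  rewrite /qform ME trmx_mul map_mxM !mulmxA -(mulmxA y) PPt mulmx1.
  rewrite -(mulmxA _ P) PPt mulmx1 mxE; apply: eq_bigr => i _.
  by rewrite mul_mx_diag !mxE mulrAC normCK mulrC.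
(* The rows of [D sg *m P] span the eigenvectors whose eigenvalue has the sign [(-1) ^+ sg]. *)
pose D (sg : bool) := diag_mx (\row_i (0 < (-1) ^+ sg * d 0 i)%R%:R : 'rV[C]_n).
have sub (sg : bool) : pos_ge (\rank (D sg *m P)) ((-1) ^+ sg *: M).
  eexists; first exact: leqnn.
  exists e => // v /submxP[u ->]; rewrite mulmxA sqP.
  set y := u *m _; have yE i : y 0 i = u 0 i * (0 < (-1) ^+ sg * d 0 i)%R%:R.
    by rewrite /y /D mul_mx_diag !mxE.
  have -> : qform ((-1) ^+ sg *: M) (y *m P) = (-1) ^+ sg * qform M (y *m P).
    by rewrite /qform -scalemxAr -scalemxAl mxE.
  rewrite qP /sqnorm !mulr_sumr; apply: ler_sum => i _; rewrite yE.
  case: (boolP (0 < _)) => [lt0|_]; last by rewrite mulr0 normr0 expr0n !mulr0.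
  rewrite mulr1 [leRHS]mulrA ler_wpM2r ?exprn_ge0// -[leRHS]ger0_norm ?(ltW lt0)//.
  by rewrite normrM normrX normrN1 expr1n mul1r; exact: de.
case: (leqP k (\rank (D false *m P))) => kr.
  left; have [U rU Ue] := sub false; rewrite scale1r in Ue.
  by exists U => //; exact: leq_trans rU.
right; have [U rU Ue] := sub true; rewrite scaleN1r in Ue.
exists U => //; apply: leq_trans rU.
have := mxrank_add (D false *m P)
  (D true *m P).
suff -> : D false *m P +
  D true *m P = P.
  by rewrite (mxrank_unit PU); move: kr; lia.
rewrite -mulmxDl -[RHS]mul1mx /D; congr (_ *m _); apply/matrixP => i j.
rewrite !mxE; case: eqVneq => [->|]; rewrite ?mulr1n ?mulr0n ?addr0//.
rewrite expr0 expr1 mul1r mulN1r oppr_gt0.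
by have := d0 j; rewrite real_neqr_lt ?dr// => /orP[] h; rewrite h (lt_gtF h) ?addr0 ?add0r.
Qed.

Lemma pos_ge_near k M : M ^t* = M -> pos_ge k M ->
  exists2 h : C, 0 < h &
    forall N, N ^t* = N -> (forall i j, `|N i j - M i j| <= h) -> pos_ge k N.
Proof.
move=> Mh [U rU [e e0 Ue]].
have n0 : 0 < n%:R + 1 :> C by rewrite ltr_wpDl.
exists (e / 2 / (n%:R + 1)); first by rewrite !divr_gt0.
move=> N Nh NM; exists U => //; exists (e / 2); first by rewrite divr_gt0.
move=> v /Ue; have -> : N = M + (N - M) by rewrite addrC subrK.
rewrite qformD.
have small : `|qform (N - M) v| <= e / 2 * sqnorm v.
  apply: le_trans (qform_small v (e := e / 2 / (n%:R + 1)) _) _.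
    by move=> i j; rewrite !mxE.
  rewrite ler_wpM2r ?sqnorm_ge0// mulrCA ler_piMr ?divr_ge0// ?ltW//.
  by rewrite ltr_pdivrMr// mul1r ltrDl.
move: small; rewrite real_ler_norml; last first.
  by apply: qform_herm_real; rewrite linearB map_mxB Mh Nh.
case/andP=> small _ eM; apply: le_trans (lerD eM small).
by rewrite -mulrBl {2}(splitr e) addrK.
Qed.

Lemma sqnorm_lower_near M : M \in unitmx ->
  exists2 h : C, 0 < h & exists2 e : C, 0 < e &
    forall N, (forall i j, `|N i j - M i j| <= h) ->
    forall v, e * sqnorm v <= sqnorm (v *m N).
Proof.
move=> Mu; pose K := 1 + \sum_i \sum_j `|invmx M i j|.
have K1 : 1 <= K.
  by rewrite lerDl sumr_ge0// => i _; rewrite sumr_ge0.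
have K0 : 0 < K by exact: lt_le_trans K1.
have KM i j : `|invmx M i j| <= K.
  apply: le_trans (_ : \sum_j `|invmx M i j| <= _).
    by rewrite (bigD1 j)//= lerDl sumr_ge0.
  rewrite /K [in leRHS](bigD1 i)//= addrCA lerDl addr_ge0// sumr_ge0// => k _.
  by rewrite sumr_ge0.
have n0 : 0 < n%:R + 1 :> C by rewrite ltr_wpDl.
(* Using [n + 1] in place of [n] keeps [c] positive for [n = 0]. For the [h] chosen below,
   [sqnorm (v *m (M - N))] is at most [sqnorm v / (4 c)]; after [sqnormD] this costs half of
   [sqnorm v], and the other half gives the bound. *)
pose c := ((n%:R + 1) * K) ^+ 2.
have c0 : 0 < c by rewrite exprn_gt0// mulr_gt0.
have lowM v : sqnorm v <= c * sqnorm (v *m M).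
  rewrite -[X in sqnorm X <= _](mulmxK Mu).
  apply: le_trans (sqnorm_mul_small _ KM) _; rewrite ler_wpM2r ?sqnorm_ge0//.
  by rewrite /c ler_pXn2r ?nnegrE ?mulr_ge0 ?ler_wpM2r ?lerDl// ltW.
exists ((n%:R + 1)^-1 * (2 * ((n%:R + 1) * K))^-1).
  by rewrite mulr_gt0 ?invr_gt0 ?mulr_gt0.
exists (4 * c)^-1; first by rewrite invr_gt0 mulr_gt0.
move=> N NM v; rewrite mulrC ler_pdivrMr ?mulr_gt0//.
have small : sqnorm (v *m (M - N)) <= (4 * c)^-1 * sqnorm v.
  apply: le_trans (sqnorm_mul_small (e := (n%:R + 1)^-1 * (2 * ((n%:R + 1) * K))^-1) _ _) _.
    by move=> i j; rewrite !mxE distrC.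
  rewrite ler_wpM2r ?sqnorm_ge0//.
  have -> : (4 * c)^-1 = ((2 * ((n%:R + 1) * K))^-1) ^+ 2.
    by rewrite /c exprVn; congr (_ ^-1); ring.
  have d0 : 0 <= (2 * ((n%:R + 1) * K))^-1 by rewrite ltW ?invr_gt0 ?mulr_gt0.
  have m0 := ltW n0.
  rewrite ler_pXn2r ?nnegrE ?mulr_ge0 ?d0 ?invr_ge0//.
  by rewrite [leLHS]mulrA ler_piMl// ler_pdivrMr// mul1r lerDl.
have := lowM v; have := sqnormD (v *m N) (v *m (M - N)).
rewrite -mulmxDr [N + _]addrC subrK => h1 h2.
have h3 : sqnorm v <= c * (2 * sqnorm (v *m N) + 2 * ((4 * c)^-1 * sqnorm v)).
  apply: le_trans h2 _; rewrite ler_wpM2l ?(ltW c0)//; apply: le_trans h1 _.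
  by rewrite lerD2l ler_wpM2l.
have E : c * (2 * ((4 * c)^-1 * sqnorm v)) = sqnorm v / 2.
  by field; exact: lt0r_neq0.
move: h3; rewrite mulrDr E -lerBlDr => h3.
have {h3}: sqnorm v / 2 <= c * (2 * sqnorm (v *m N)).
  by apply: le_trans h3; rewrite le_eqVlt; apply/orP; left; apply/eqP; field.
rewrite ler_pdivrMr// => /le_trans; apply.
by rewrite le_eqVlt; apply/orP; left; apply/eqP; ring.
Qed.

Lemma herm_eigenvalue_real M a v : M ^t* = M -> v != 0 -> v *m M = a *: v ->
  a \is Num.real.
Proof.
move=> Mh v0 vM; have qE : qform M v = a * sqnorm v.
  by rewrite -qform_scalar /qform mul_mx_scalar vM.
have s0 : sqnorm v != 0 by rewrite sqnorm_eq0.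
rewrite -(mulfK s0 a) -qE rpred_div ?qform_herm_real//.
by rewrite ger0_real ?sqnorm_ge0.
Qed.

Lemma pos_ge_eigenvector M v a : 0 < a -> v != 0 -> v *m M = a *: v ->
  pos_ge 1 M.
Proof.
move=> a0 v0 vM; exists (<<v>>%MS); first by rewrite genmxE rank_rV v0.
exists a => // w; rewrite genmxE => /sub_rVP[b ->].
rewrite (_ : qform M (b *: v) = a * sqnorm (b *: v))//.
by rewrite -qform_scalar /qform mul_mx_scalar -[b *: v *m M]scalemxAl vM !scalerA mulrC.
Qed.

End QuadraticForms.

(** * The Floquet symbol *)

Section FloquetSymbol.
Variable C : numClosedFieldType.
Implicit Types (z : C) (X : 'M[C]_3).

Definition hop z : 'M[C]_3 :=
  \matrix_(j, k) if k == j then 1 else if k == j + 1 then z^-1 else z.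

Definition site_sign (j : 'I_3) : C := if j == 0 then -1 else 1.
Definition sgnmx : 'M[C]_3 := diag_mx (\row_j site_sign j).

(* With [A = 1 + shift + shift^-1] on the line, [H + 1 = A (x) A + l eps (x) eps];
   [hop z] is [A] on functions of quasi-momentum [z], and ['M_(3 * 3)] acts on
   vectorised 3 x 3 matrices. *)
Definition symbol (l z1 z2 : C) : 'M[C]_(3 * 3) :=
  lin_mulmx (hop z1) *m lin_mulmxr (hop z2)^T +
  l *: (lin_mulmx sgnmx *m lin_mulmxr sgnmx).

Definition symbol_op l z1 z2 X : 'M[C]_3 :=
  hop z1 *m X *m (hop z2)^T + l *: (sgnmx *m X *m sgnmx).

Lemma mxvec_symbol l z1 z2 X :
  mxvec X *m symbol l z1 z2 = mxvec (symbol_op l z1 z2 X).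
Proof.
by rewrite mulmxDr -scalemxAr !mulmxA !mul_vec_lin /= linearD linearZ.
Qed.

Lemma symbolE l z1 z2 i j k m :
  symbol l z1 z2 (mxvec_index i j) (mxvec_index k m) =
  hop z1 k i * hop z2 m j + l * (sgnmx k i * sgnmx j m).
Proof.
have -> : symbol l z1 z2 (mxvec_index i j) (mxvec_index k m) =
  (mxvec (delta_mx i j) *m symbol l z1 z2) 0 (mxvec_index k m).
  by rewrite mxvec_delta -rowE [RHS]mxE.
rewrite mxvec_symbol mxvecE !mxE; congr (_ + _ * _).
  rewrite (bigD1 j)//= big1 ?addr0; last first.
    move=> a aj; rewrite mxE big1 ?mul0r// => b _.
    by rewrite !mxE (negbTE aj) andbF mulr0.
  rewrite !mxE (bigD1 i)//= big1 ?addr0; last first.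
    by move=> b bi; rewrite !mxE (negbTE bi) mulr0.
  by rewrite !mxE !eqxx mulr1.
rewrite (bigD1 j)//= big1 ?addr0; last first.
  move=> a aj; rewrite mxE big1 ?mul0r// => b _.
  by rewrite !mxE (negbTE aj) andbF mulr0.
rewrite !mxE (bigD1 i)//= big1 ?addr0; last first.
  by move=> b bi; rewrite !mxE (negbTE bi) mulr0.
by rewrite !mxE !eqxx mulr1.
Qed.

Lemma norm1_conj z : `|z| = 1 -> z^* = z^-1.
Proof.
move=> z1; rewrite invC_norm z1 expr1n invr1 mul1r//.
Qed.

Lemma hop_conj z i j : `|z| = 1 -> (hop z i j)^* = hop z j i.
Proof.
move=> /norm1_conj zc; rewrite !mxE.
by case: i => [[|[|[|//]]] hi]; case: j => [[|[|[|//]]] hj] /=;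
  rewrite -?val_eqE /= ?rmorph1 ?fmorphV /= ?zc ?invrK.
Qed.

Lemma symbol_herm (l z1 z2 : C) : l \is Num.real -> `|z1| = 1 -> `|z2| = 1 ->
  (symbol l z1 z2) ^t* = symbol l z1 z2.
Proof.
move=> /CrealP lr h1 h2; apply/matrixP => p q.
have -> (M : 'M[C]_(3 * 3)) : (M ^t*) p q = (M q p)^* by rewrite !mxE.
case/mxvec_indexP: p => i j; case/mxvec_indexP: q => k m.
rewrite !symbolE rmorphD !rmorphM /= !hop_conj// lr; congr (_ + _ * _).
have Sc a b : (sgnmx a b)^* = sgnmx b a.
  rewrite !mxE eq_sym; case: eqVneq => [->|_]; rewrite ?mulr1n ?mulr0n ?rmorph0//.
  by rewrite /site_sign; case: ifP => _; rewrite ?rmorphN rmorph1.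
by rewrite !Sc.
Qed.

Lemma hop_norm z i j : `|z| = 1 -> `|hop z i j| = 1.
Proof. by move=> z1; rewrite mxE; case: ifP => _; [|case: ifP => _]; rewrite ?normfV ?normr1 ?z1 ?invr1. Qed.

Lemma hop_lip z z' i j : `|z| = 1 -> `|z'| = 1 ->
  `|hop z i j - hop z' i j| <= `|z - z'|.
Proof.
move=> h h'; rewrite !mxE; case: ifP => _; first by rewrite subrr normr0.
case: ifP => _ //.
rewrite -(norm1_conj h) -(norm1_conj h') -rmorphB norm_conjC//.
Qed.

Lemma symbol_lip (l z1 z2 w1 w2 : C) p q :
  `|z1| = 1 -> `|z2| = 1 -> `|w1| = 1 -> `|w2| = 1 ->
  `|symbol l z1 z2 p q - symbol l w1 w2 p q| <= `|z1 - w1| + `|z2 - w2|.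
Proof.
move=> h1 h2 k1 k2.
case/mxvec_indexP: p => i j; case/mxvec_indexP: q => k m; rewrite !symbolE.
set a := hop z1 _ _; set b := hop z2 _ _; set a' := hop w1 _ _; set b' := hop w2 _ _.
rewrite (_ : _ - _ = (a - a') * b + a' * (b - b')); last by ring.
apply: le_trans (ler_normD _ _) _; rewrite !normrM !hop_norm// mul1r mulr1.
by rewrite lerD// hop_lip.
Qed.

(** Cayley-Hamilton: [N] has trace 1, its principal 2 x 2 minors vanish because opposite entries of
    [hop z] multiply to 1, and its determinant is the scalar on the right. *)
Lemma sgn_hop_cubic z : z != 0 ->
  let N := sgnmx *m hop z in
  N *m (N *m N) = N *m N + (2 - z ^+ 3 - z ^- 3)%:M.
Proof.
move=> z0 N; apply/matrixP => i j.
have Nij a b : N a b = site_sign a * hop z a b by rewrite /N mul_diag_mx !mxE.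
move: N Nij => N Nij.
rewrite !mxE !big_ord_recl !big_ord0 !mxE !big_ord_recl !big_ord0 !Nij.
rewrite /site_sign !mxE.
case: i => [[|[|[|//]]] hi]; case: j => [[|[|[|//]]] hj];
  rewrite -?val_eqE /= ?mulr1n ?mulr0n; field; exact: z0.
Qed.

End FloquetSymbol.

(** * The gap at zero *)

(** The product of [x * y + l] over the roots x of x^3 = x^2 + s and y of y^3 = y^2 + t, expanded in
    elementary symmetric functions. *)
Definition gap_resultant (K : pzRingType) (l s t : K) : K :=
  s * t * (s * t - l ^+ 2) ^+ 2 - l ^+ 5 * (s * t) + l ^+ 9
  + 3 * l ^+ 6 * (s * t) + 3 * l ^+ 3 * (s * t) ^+ 2 + l ^+ 6 * (s + t) + l ^+ 8.

(** With x = s t and the square kept intact, the only negative term is - l^5 x. If 3 x >= l^2, the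
    term 3 l^3 x^2 absorbs it. Otherwise |x - l^2| >= (2/3) l^2, and l <= (2/3)^2 lets the square
    absorb it; this is the origin of 4/9. *)
Lemma gap_resultant_gt0 (K : realFieldType) (l s t : K) :
  0 < l -> l <= 4 / 9 -> 0 <= s -> 0 <= t -> 0 < gap_resultant l s t.
Proof.
move=> l0 l49 s0 t0; rewrite /gap_resultant; have l0' := ltW l0.
have x0 : 0 <= s * t by rewrite mulr_ge0.
have st0 : 0 <= s + t by rewrite addr_ge0.
have p6 : 0 <= l ^+ 6 * (s + t) by rewrite mulr_ge0// ?exprn_ge0.
move: (s + t) p6 => u p6 {st0}; move: (s * t) x0 => x x0.
have p8 : 0 < l ^+ 8 by rewrite exprn_gt0.
have p9 : 0 < l ^+ 9 by rewrite exprn_gt0.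
have p6x : 0 <= 3 * l ^+ 6 * x by rewrite !mulr_ge0// ?exprn_ge0.
have [xl|xl] := lerP (l ^+ 2) (3 * x).
  have : 0 <= l ^+ 3 * x * (3 * x - l ^+ 2).
    by rewrite !mulr_ge0 ?subr_ge0// ?exprn_ge0.
  have : 0 <= x * (x - l ^+ 2) ^+ 2 by rewrite mulr_ge0// sqr_ge0.
  rewrite (_ : l ^+ 3 * x * (3 * x - l ^+ 2) = 3 * l ^+ 3 * x ^+ 2 - l ^+ 5 * x); last by ring.
  by lra.
have h1 : 4 / 9 * l ^+ 4 <= (x - l ^+ 2) ^+ 2.
  rewrite (_ : 4 / 9 * l ^+ 4 = (2 / 3 * l ^+ 2) ^+ 2); last by field.
  have l2 : 0 <= l ^+ 2 by rewrite exprn_ge0.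
  by rewrite -[leRHS]sqrrN ler_pXn2r ?nnegrE//; lra.
have h2 : l ^+ 5 <= 4 / 9 * l ^+ 4.
  by rewrite exprS ler_wpM2r ?exprn_ge0.
have : 0 <= x * ((x - l ^+ 2) ^+ 2 - l ^+ 5).
  by rewrite mulr_ge0// subr_ge0 (le_trans h2 h1).
have : 0 <= 3 * l ^+ 3 * x ^+ 2 by rewrite !mulr_ge0 ?exprn_ge0.
rewrite mulrBr; lra.
Qed.

Section Gap.
Variable C : numClosedFieldType.

Lemma sgnmx_sqr : sgnmx C *m sgnmx C = 1%:M.
Proof.
apply/matrixP => i j; rewrite mul_diag_mx !mxE.
case: (eqVneq i j) => [->|_]; last by rewrite !mulr0n mulr0.
by rewrite !mulr1n /site_sign; case: ifP => _; rewrite ?mulrNN mulr1.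
Qed.

(* Left multiplication by [N] and right multiplication by [M] are commuting
   operators with product [- l] on [X], both satisfying a cubic equation;
   [gap_resultant] is the resultant that excludes a joint eigenvalue. *)
Lemma cubic_pencil_inj n (N M X : 'M[C]_n) l s t :
  N *m N *m N = N *m N + s%:M -> M *m M *m M = M *m M + t%:M ->
  N *m X *m M = (- l) *: X -> gap_resultant l s t != 0 -> X = 0.
Proof.
move=> N3 M3 NXM res0.
pose Y1 := N *m X; pose Y2 := N *m Y1.
have NY2 : N *m Y2 = Y2 + s *: X.
  by rewrite /Y2 /Y1 !mulmxA N3 mulmxDl mul_scalar_mx.
have NXM2 : N *m N *m X *m M *m M = l ^+ 2 *: X.
  rewrite -(mulmxA N) -(mulmxA N) NXM -scalemxAr -scalemxAl NXM scalerA.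
  by congr (_ *: _); ring.
(* This is N^3 X M^3 = - l^3 X with both cubes reduced by the cubic equations. Multiplying by [N]
   and reducing again gives [e2] and [e3]: a linear system in [Y2], [Y1], [X] whose determinant is
   [gap_resultant] up to sign. *)
have e1 : t *: Y2 + l ^+ 2 *: Y1 + (l ^+ 3 + t * s) *: X = 0.
  have : N *m (N *m N *m X *m M *m M) *m M = (- l ^+ 3) *: X.
    rewrite NXM2 -scalemxAr -scalemxAl NXM scalerA; congr (_ *: _); ring.
  rewrite -!mulmxA (mulmxA M) M3 mulmxDr mulmxDr mulmxDr mulmxDr.
  have -> : N *m (N *m (N *m (X *m (M *m M)))) = l ^+ 2 *: Y1.
    by rewrite /Y1 scalemxAr -NXM2 -!mulmxA.
  rewrite !mul_mx_scalar -!scalemxAr -/Y1 -/Y2 NY2.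
  clearbody Y2 Y1; move=> /matrixP h; apply/matrixP => i j; move: (h i j); rewrite !mxE => h1.
  by move/eqP: h1; rewrite -subr_eq0 => /eqP <-; ring.
have e2 : (t + l ^+ 2) *: Y2 + (l ^+ 3 + t * s) *: Y1 + (t * s) *: X = 0.
  have := congr1 (mulmx N) e1; rewrite mulmx0 !mulmxDr -!scalemxAr NY2 -/Y1 -/Y2.
  by clearbody Y2 Y1; move=> <-; apply/matrixP => i j; rewrite !mxE; ring.
have e3 : (t + l ^+ 2 + (l ^+ 3 + t * s)) *: Y2 + (t * s) *: Y1 +
    ((t + l ^+ 2) * s) *: X = 0.
  have := congr1 (mulmx N) e2; rewrite mulmx0 !mulmxDr -!scalemxAr NY2 -/Y1 -/Y2.
  by clearbody Y2 Y1; move=> <-; apply/matrixP => i j; rewrite !mxE; ring.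
clearbody Y2 Y1; apply/matrixP => i j; rewrite mxE; apply/eqP.
suff /eqP : gap_resultant l s t * X i j = 0 by rewrite mulf_eq0 (negbTE res0).
have /matrixP /(_ i j) := e1; have /matrixP /(_ i j) := e2.
have /matrixP /(_ i j) := e3; rewrite !mxE.
move: (X i j) (Y1 i j) (Y2 i j) => y0 y1 y2 E3 E2 E1.
pose c := l ^+ 3 + t * s; pose a := l ^+ 2.
(* Cramer's rule: the cofactors of the last column eliminate [y2] and [y1]. *)
transitivity (- (((t + a) * (t * s) - c * (t + a + c)) * (t * y2 + a * y1 + c * y0)
  - (t * (t * s) - a * (t + a + c)) * ((t + a) * y2 + c * y1 + t * s * y0)
  + (t * c - a * (t + a)) * ((t + a + c) * y2 + t * s * y1 + (t + a) * s * y0))).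
  by rewrite /gap_resultant /c /a; ring.
by rewrite E1 E2 E3 !mulr0 subrr addr0 oppr0.
Qed.

Lemma symbol_op_inj (l z1 z2 : C) (X : 'M[C]_3) : z1 != 0 -> z2 != 0 ->
  gap_resultant l (2 - z1 ^+ 3 - z1 ^- 3) (2 - z2 ^+ 3 - z2 ^- 3) != 0 ->
  symbol_op l z1 z2 X = 0 -> X = 0.
Proof.
move=> z10 z20 + sX0; apply: (@cubic_pencil_inj _ (sgnmx C *m hop z1) ((hop z2)^T *m sgnmx C)).
- by rewrite -mulmxA; exact: sgn_hop_cubic.
- have := congr1 trmx (sgn_hop_cubic z20).
  by rewrite linearD /= tr_scalar_mx !trmx_mul tr_diag_mx mulmxA.
have : sgnmx C *m symbol_op l z1 z2 X *m sgnmx C = 0.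
  by rewrite sX0 mulmx0 mul0mx.
rewrite /symbol_op mulmxDr mulmxDl -scalemxAr -scalemxAl !mulmxA.
rewrite sgnmx_sqr mul1mx -(mulmxA X) sgnmx_sqr mulmx1 => /eqP.
by rewrite addr_eq0 -scaleNr => /eqP.
Qed.

End Gap.

(** * Index at the special momenta *)

Section SpecialMomenta.
Variable C : numClosedFieldType.
Implicit Types (X Y : 'M[C]_3) (l mu c z : C).

Definition frob X Y : C := \sum_i \sum_j X i j * (Y i j)^*.

Lemma sum_mxvec (F : 'I_(3 * 3) -> C) :
  \sum_p F p = \sum_i \sum_j F (mxvec_index i j).
Proof.
rewrite pair_bigA (reindex (uncurry (@mxvec_index 3 3))) /=.
  by apply: eq_bigr => -[].
exact: curry_mxvec_bij.
Qed.

Lemma sqnorm_mxvec X : sqnorm (mxvec X) = frob X X.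
Proof.
rewrite /sqnorm sum_mxvec; apply: eq_bigr => i _; apply: eq_bigr => j _.
by rewrite mxvecE normCK.
Qed.

Lemma qform_symbol l z1 z2 X :
  qform (symbol l z1 z2) (mxvec X) = frob (symbol_op l z1 z2 X) X.
Proof.
rewrite qformE mxvec_symbol sum_mxvec; apply: eq_bigr => i _.
by apply: eq_bigr => j _; rewrite !mxvecE.
Qed.

Lemma frob_symbol_op l z1 z2 X : frob (symbol_op l z1 z2 X) X =
  frob (hop z1 *m X *m (hop z2)^T) X + l * frob (sgnmx C *m X *m sgnmx C) X.
Proof.
rewrite mulr_sumr -big_split; apply: eq_bigr => i _ /=.
rewrite mulr_sumr -big_split; apply: eq_bigr => j _ /=.
rewrite /symbol_op; move: (_ *m X *m _) (_ *m X *m _) => A B.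
by rewrite !mxE mulrDl mulrA.
Qed.

Lemma frob_sgn_real_bounds X :
  - frob X X <= frob (sgnmx C *m X *m sgnmx C) X <= frob X X.
Proof.
have E i j : (sgnmx C *m X *m sgnmx C) i j = site_sign C i * site_sign C j * X i j.
  by rewrite mul_mx_diag mxE mul_diag_mx !mxE mulrAC.
have sg i j : site_sign C i * site_sign C j = 1 \/ site_sign C i * site_sign C j = -1.
  rewrite /site_sign; case: ifP => _; case: ifP => _;
    rewrite ?mulrNN ?mul1r ?mulr1; by [left|right].
rewrite /frob -sumrN; apply/andP; split; apply: ler_sum => i _; rewrite -?sumrN;
  apply: ler_sum => j _; rewrite E -mulrA -normCK;
  case: (sg i j) => ->; rewrite ?mul1r ?mulN1r// -subr_ge0 ?opprK ?addr_ge0 ?exprn_ge0//.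
Qed.

(** A subspace cut out by [m * p] linear conditions; the index bounds below count conditions instead
    of exhibiting eigenvectors. *)
Definition ker2 m p (L : 'M[C]_(m, 3)) (R : 'M[C]_(3, p)) : 'M[C]_(3 * 3) :=
  kermx (lin_mulmx L *m lin_mulmxr R).

Lemma rank_ker2 m p (L : 'M[C]_(m, 3)) (R : 'M[C]_(3, p)) :
  (9 - m * p <= \rank (ker2 L R))%N.
Proof. by rewrite mxrank_ker leq_sub2l// rank_leq_col. Qed.

Lemma ker2P m p (L : 'M[C]_(m, 3)) (R : 'M[C]_(3, p)) X :
  (mxvec X <= ker2 L R)%MS -> L *m X *m R = 0.
Proof.
move/sub_kermxP; rewrite mulmxA !mul_vec_lin /= => h.
by rewrite -[LHS]mxvecK h linear0.
Qed.

(** Conjugation by [sgnmx] only flips signs of entries, so the potential changes the form by at most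
    [l * frob X X]: a bound [c] for A (x) A survives as [c - l]. *)
Lemma symbol_pos_ge k (U : 'M[C]_(3 * 3)) l c mu z1 z2 :
  (k <= \rank U)%N -> 0 <= l -> mu < c - l ->
  (forall X, (mxvec X <= U)%MS ->
    c * frob X X <= frob (hop z1 *m X *m (hop z2)^T) X) ->
  pos_ge k (symbol l z1 z2 - mu%:M).
Proof.
move=> rU l0 mu_lt TX; exists U => //; exists (c - l - mu); first by rewrite subr_gt0.
move=> v; rewrite -[v]vec_mxK; move: (vec_mx v) => X XU.
rewrite qformB qform_scalar qform_symbol sqnorm_mxvec frob_symbol_op mulrBl lerD2r.
have /andP[lo _] := frob_sgn_real_bounds X.
by rewrite mulrBl -mulrN lerD ?TX// ler_wpM2l.
Qed.

Lemma symbol_neg_ge k (U : 'M[C]_(3 * 3)) l c mu z1 z2 :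
  (k <= \rank U)%N -> 0 <= l -> c + l < mu ->
  (forall X, (mxvec X <= U)%MS ->
    frob (hop z1 *m X *m (hop z2)^T) X <= c * frob X X) ->
  pos_ge k (- (symbol l z1 z2 - mu%:M)).
Proof.
move=> rU l0 mu_lt TX; exists U => //; exists (mu - (c + l)); first by rewrite subr_gt0.
move=> v; rewrite -[v]vec_mxK; move: (vec_mx v) => X XU.
rewrite opprB qformB qform_scalar qform_symbol sqnorm_mxvec frob_symbol_op mulrBl.
have /andP[_ hi] := frob_sgn_real_bounds X.
by rewrite lerB// mulrDl lerD ?TX// ler_wpM2l.
Qed.

Definition ones m p : 'M[C]_(m, p) := const_mx 1.

(** The equation [diffs *m Y = 0] makes all rows of [Y] equal. Together with [ones], on either side,
    it cuts out the joint eigenspaces of J and 2 - J. *)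
Definition diffs : 'M[C]_(2, 3) :=
  \matrix_(i, j) if j == 0 then 1 else if j == i.+1 :> nat then -1 else 0.

Lemma hop1E : hop 1 = const_mx 1 :> 'M[C]_3.
Proof. by apply/matrixP => i j; rewrite !mxE invr1 !if_same. Qed.

Lemma hopN1E : hop (-1) = 2%:M - const_mx 1 :> 'M[C]_3.
Proof.
apply/matrixP => i j; rewrite !mxE invrN1 if_same eq_sym.
by case: eqP => _; rewrite ?mulr1n ?mulr0n; ring.
Qed.

Definition total X : C := \sum_i \sum_j X i j.

Lemma hop11_apply X i j : (hop 1 *m X *m (hop 1)^T) i j = total X.
Proof.
rewrite hop1E mxE /total exchange_big; apply: eq_bigr => k _; rewrite !mxE mulr1.
by apply: eq_bigr => m _; rewrite mxE mul1r.
Qed.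

Lemma hop1N1_apply X i j :
  (hop 1 *m X *m (hop (-1))^T) i j = 2 * (\sum_k X k j) - total X.
Proof.
rewrite hopN1E linearB /= tr_scalar_mx trmx_const mulmxBr mul_mx_scalar.
rewrite -(hop11_apply X i j) hop1E trmx_const !mxE; congr (_ * _ - _).
by apply: eq_bigr => k _; rewrite mxE mul1r.
Qed.

Lemma hopN1N1_apply X i j : (hop (-1) *m X *m (hop (-1))^T) i j =
  4 * X i j - 2 * (\sum_k X k j) - 2 * (\sum_k X i k) + total X.
Proof.
rewrite hopN1E linearB /= tr_scalar_mx trmx_const mulmxBr mul_mx_scalar.
rewrite mulmxBl mul_scalar_mx mulmxBl -scalemxAl.
rewrite -(hop11_apply X i j) hop1E trmx_const.
move: (const_mx 1 *m X *m const_mx 1) => A.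
rewrite !mxE.
have -> : \sum_j0 const_mx 1 i j0 * X j0 j = \sum_k X k j.
  by apply: eq_bigr => k _; rewrite mxE mul1r.
have -> : \sum_j0 X i j0 * const_mx 1 j0 j = \sum_k X i k.
  by apply: eq_bigr => k _; rewrite mxE mulr1.
ring.
Qed.

Lemma frob_hop11_ge0 X : 0 * frob X X <= frob (hop 1 *m X *m (hop 1)^T) X.
Proof.
suff -> : frob (hop 1 *m X *m (hop 1)^T) X = `|total X| ^+ 2.
  by rewrite mul0r exprn_ge0.
rewrite normCK {2}/total rmorph_sum mulr_sumr; apply: eq_bigr => i _.
rewrite rmorph_sum mulr_sumr; apply: eq_bigr => j _.
by rewrite hop11_apply.
Qed.

Lemma ker2_ones X : (mxvec X <= ker2 (ones 1 3) (ones 3 1))%MS -> total X = 0.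
Proof.
move=> /ker2P /matrixP /(_ 0 0); rewrite !mxE => h; rewrite -[RHS]h /total exchange_big.
apply: eq_bigr => k _; rewrite !mxE mulr1.
by apply: eq_bigr => m _; rewrite mxE mul1r.
Qed.

Lemma diffs_mul p (Y : 'M[C]_(3, p)) : diffs *m Y = 0 -> forall i j, Y i j = Y 0 j.
Proof.
move=> /matrixP h i j.
have := h 0 j; have := h 1 j; rewrite !mxE !big_ord_recl !big_ord0 !mxE /=.
rewrite !mul1r !mul0r !mulN1r !add0r !addr0 => /eqP; rewrite subr_eq0 => /eqP h1.
move=> /eqP; rewrite subr_eq0 => /eqP h0.
case: i => [[|[|[|//]]] hi]; first by congr (Y _ _); exact: val_inj.
  by rewrite [RHS](_ : _ = Y ord0 j)// h0; congr (Y _ _); exact: val_inj.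
by rewrite [RHS](_ : _ = Y ord0 j)// h1; congr (Y _ _); exact: val_inj.
Qed.

(** At (1, 1) the form of A (x) A is [|total X| ^+ 2], nonnegative everywhere and zero on the
    hyperplane of total 0; hence the indices 9 here and 8 in the next lemma. *)
Lemma pos_ge_11 l mu : 0 <= l -> mu < - l -> pos_ge 9 (symbol l 1 1 - mu%:M).
Proof.
move=> l0 mul; apply: (@symbol_pos_ge _ 1%:M _ 0) => //; first by rewrite mxrank1.
  by rewrite add0r.
by move=> X _; exact: frob_hop11_ge0.
Qed.

Lemma neg_ge_11 l mu : 0 <= l -> l < mu ->
  pos_ge 8 (- (symbol l 1 1 - mu%:M)).
Proof.
move=> l0 lmu; apply: (@symbol_neg_ge _ (ker2 (ones 1 3) (ones 3 1)) _ 0) => //.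
- exact: (rank_ker2 (ones 1 3) (ones 3 1)).
- by rewrite add0r.
move=> X /ker2_ones X0; rewrite mul0r /frob big1// => i _; rewrite big1// => j _.
by rewrite hop11_apply X0 mul0r.
Qed.

Lemma frobZ c X Y : (forall i j, X i j = c * Y i j) -> frob X Y = c * frob Y Y.
Proof.
move=> XY; rewrite mulr_sumr; apply: eq_bigr => i _; rewrite mulr_sumr.
by apply: eq_bigr => j _; rewrite XY mulrA.
Qed.

Lemma rank_cap_ker2 k (U W : 'M[C]_(3 * 3)) :
  (k + 9 <= \rank U + \rank W)%N -> (k <= \rank (U :&: W))%N.
Proof.
by have := mxrank_sum_cap U W; have := rank_leq_col (U + W)%MS; lia.
Qed.

(** On matrices with equal rows and total 0, J acts on the left as 3 and 2 - J on the right as 2.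
    These are 6 + 1 conditions, leaving dimension 2. *)
Lemma pos_ge_1N1 l mu : 0 <= l -> mu < 6 - l ->
  pos_ge 2 (symbol l 1 (-1) - mu%:M).
Proof.
move=> l0 mul.
apply: (@symbol_pos_ge _ (ker2 diffs 1%:M :&: ker2 (ones 1 3) (ones 3 1))%MS _ 6) => //.
  apply: rank_cap_ker2; have := rank_ker2 diffs (1%:M : 'M[C]_3).
  have := rank_ker2 (ones 1 3) (ones 3 1); lia.
move=> X; rewrite sub_capmx => /andP[/ker2P + /ker2_ones X0].
rewrite mulmx1 => /diffs_mul Xrow.
rewrite [leRHS](@frobZ 6 _ X)// => i j; rewrite hop1N1_apply X0.
by rewrite !big_ord_recl big_ord0 !(Xrow _ j); ring.
Qed.

Lemma neg_ge_N1N1 l mu : 0 <= l -> 4 + l < mu ->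
  pos_ge 9 (- (symbol l (-1) (-1) - mu%:M)).
Proof.
move=> l0 mul; apply: (@symbol_neg_ge _ 1%:M _ 4) => //; first by rewrite mxrank1.
move=> X _; rewrite -subr_ge0.
pose S := total X; pose q (z : C) := z * z^*.
have q0 z : 0 <= q z by rewrite /q -normCK exprn_ge0.
(* A sum of squares for 4 - (2 - J) (x) (2 - J): row and column sums are centred at their mean
   [S / 3]. *)
rewrite [leRHS](_ : _ = 2 * (\sum_i q ((\sum_k X i k) - S / 3)) +
  2 * (\sum_j q ((\sum_k X k j) - S / 3)) + q S / 3).
  have s0 (F : 'I_3 -> C) : 0 <= \sum_i q (F i) by apply: sumr_ge0.
  by apply: addr_ge0; [apply: addr_ge0|]; rewrite mulr_ge0 ?s0 ?invr_ge0.
have -> : frob (hop (-1) *m X *m (hop (-1))^T) X = \sum_i \sum_j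
    (4 * X i j - 2 * (\sum_k X k j) - 2 * (\sum_k X i k) + S) * (X i j)^*.
  by apply: eq_bigr => i _; apply: eq_bigr => j _; rewrite hopN1N1_apply.
rewrite /frob /q.
rewrite /S /total !big_ord_recl !big_ord0 !rmorphB !rmorphM !rmorphD /= !fmorphV !rmorph_nat !rmorph0.
by field.
Qed.

Lemma frob_shift X b : \sum_i \sum_j (X i j - b) * (X i j - b)^* =
  frob X X - b * (total X)^* - total X * b^* + 9 * (b * b^*).
Proof.
have -> : 9 * (b * b^*) = \sum_(i < 3) \sum_(j < 3) b * b^*.
  by rewrite !sumr_const card_ord -mulrnA mulr_natl.
rewrite /total /frob rmorph_sum mulr_sumr mulr_suml -!sumrB -big_split /=.
apply: eq_bigr => i _.
rewrite rmorph_sum mulr_sumr mulr_suml -!sumrB -big_split /=.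
by apply: eq_bigr => j _; rewrite rmorphB /=; ring.
Qed.

(** On matrices with equal row sums and equal column sums the eigenvalues are 4 (all sums zero) and
    1 (constants). These are 2 + 2 conditions, leaving dimension 5. *)
Lemma pos_ge_N1N1 l mu : 0 <= l -> mu < 1 - l ->
  pos_ge 5 (symbol l (-1) (-1) - mu%:M).
Proof.
move=> l0 mul.
apply: (symbol_pos_ge (U := (ker2 diffs (ones 3 1) :&: ker2 (ones 1 3) diffs^T)%MS) (c := 1)) => //.
  apply: rank_cap_ker2; have := rank_ker2 diffs (ones 3 1).
  have := rank_ker2 (ones 1 3) diffs^T; lia.
move=> X; rewrite sub_capmx => /andP[/ker2P + /ker2P].
rewrite -mulmxA => /diffs_mul Xr /(congr1 trmx).
rewrite trmx_mul trmxK trmx0 => /diffs_mul Xc.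
have {}Xr i : \sum_k X i k = total X / 3.
  have rE k : \sum_m X k m = (X *m ones 3 1) k 0.
    by rewrite mxE; apply: eq_bigr => m _; rewrite mxE mulr1.
  rewrite /total (eq_bigr _ (fun k _ => rE k)) (eq_bigr _ (fun k _ => Xr k 0)).
  by rewrite sumr_const card_ord rE Xr -[_ *+ 3]mulr_natr mulfK ?pnatr_eq0.
have {}Xc j : \sum_k X k j = total X / 3.
  have cE k : \sum_m X m k = (ones 1 3 *m X)^T k 0.
    by rewrite !mxE; apply: eq_bigr => m _; rewrite mxE mul1r.
  rewrite /total exchange_big (eq_bigr _ (fun k _ => cE k)) (eq_bigr _ (fun k _ => Xc k 0)).
  by rewrite sumr_const card_ord cE Xc -[_ *+ 3]mulr_natr mulfK ?pnatr_eq0.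
pose S := total X; pose q (z : C) := z * z^*.
have q0 z : 0 <= q z by rewrite /q -normCK exprn_ge0.
rewrite -subr_ge0 [leRHS](_ : _ = 3 * (\sum_i \sum_j q (X i j - S / 9))).
  by rewrite mulr_ge0// sumr_ge0// => i _; rewrite sumr_ge0.
have -> : frob (hop (-1) *m X *m (hop (-1))^T) X = 4 * frob X X - S / 3 * S^*.
  rewrite {2}/S /total rmorph_sum !mulr_sumr -sumrB; apply: eq_bigr => i _.
  rewrite rmorph_sum !mulr_sumr -sumrB; apply: eq_bigr => j _.
  by rewrite hopN1N1_apply Xr Xc -/S; field.
rewrite frob_shift -/S.
rewrite /q !rmorphM !fmorphV !rmorph_nat.
by field.
Qed.

(** Vanishing mixed differences mean that X i j = a i + b j; with total 0 such matrices have
    eigenvalue 2 * (-1). These are 4 + 1 conditions, leaving dimension 4. *)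
Lemma neg4_ge_N1N1 l mu : 0 <= l -> - 2 + l < mu ->
  pos_ge 4 (- (symbol l (-1) (-1) - mu%:M)).
Proof.
move=> l0 mul.
apply: (symbol_neg_ge (U := (ker2 diffs diffs^T :&: ker2 (ones 1 3) (ones 3 1))%MS) (c := (-2))) => //.
  apply: rank_cap_ker2; have := rank_ker2 diffs diffs^T.
  have := rank_ker2 (ones 1 3) (ones 3 1); lia.
move=> X; rewrite sub_capmx => /andP[/ker2P + /ker2_ones X0].
rewrite -mulmxA => /diffs_mul Xd.
have Xij i j : X i j = X i 0 + X 0 j - X 0 0.
  have XDE k m : (X *m diffs^T) k m = X k 0 - X k (lift 0 m).
    rewrite mxE !big_ord_recl big_ord0 !mxE /= mulr1 addr0.
    by case: m => [[|[|//]] hm]; rewrite /= ?mulr0 ?mulrN1 ?addr0 ?add0r;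
      congr (_ - X k _); exact: val_inj.
  case: (unliftP 0 j) => [m|] ->; last by rewrite addrK.
  have := Xd i m; rewrite !XDE => h.
  by rewrite -[LHS](subKr (X i 0)) h; ring.
have [a [b {}Xij]] : exists a b : 'I_3 -> C, forall i j, X i j = a i + b j.
  by exists (fun i => X i 0), (fun j => X 0 j - X 0 0) => i j; rewrite addrA -Xij.
rewrite [leLHS](frobZ (c := -2) (Y := X))// => i j; rewrite hopN1N1_apply X0 addr0.
have ab : \sum_k a k + \sum_k b k = 0.
  transitivity (3^-1 * total X); last by rewrite X0 mulr0.
  rewrite /total; under [in RHS]eq_bigr do under eq_bigr do rewrite Xij.
  by rewrite !big_ord_recl !big_ord0; field.
have -> : \sum_k X k j = \sum_k a k + 3 * b j.
  rewrite (eq_bigr _ (fun k _ => Xij k j)) big_split /= sumr_const card_ord.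
  by rewrite mulr_natl.
have -> : \sum_k X i k = 3 * a i + \sum_k b k.
  rewrite (eq_bigr _ (fun k _ => Xij i k)) big_split /= sumr_const card_ord.
  by rewrite mulr_natl.
rewrite Xij.
rewrite (_ : \sum_i a i = - \sum_k b k); first by ring.
by apply/eqP; rewrite -addr_eq0 ab.
Qed.

End SpecialMomenta.

(** * The Floquet spectrum *)

Section Torus.
Variable R : realType.
Implicit Types (t : R) (th : R * R).

Definition cis t : R[i] := cos t +i* sin t.

Lemma norm_cis t : `|cis t| = 1.
Proof. by rewrite normc_def /= cos2Dsin2 sqrtr1. Qed.

Lemma cis_neq0 t : cis t != 0.
Proof. by rewrite -normr_eq0 norm_cis oner_eq0. Qed.

Lemma cis0 : cis 0 = 1.
Proof. by rewrite /cis cos0 sin0. Qed.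

Lemma cispi : cis pi = -1.
Proof. by apply/eqP; rewrite eq_complex /= cospi sinpi oppr0 !eqxx. Qed.

Lemma cisD s t : cis (s + t) = cis s * cis t.
Proof. by rewrite /cis sinD cosD; apply/eqP; rewrite eq_complex /= eqxx /= addrC. Qed.

Lemma norm_complex_le (a b : R) : `|a +i* b| <= (`|a| + `|b|)%:C.
Proof.
rewrite normc_def lecR /= -[leRHS]ger0_norm ?addr_ge0// -sqrtr_sqr ler_sqrt ?sqr_ge0//.
rewrite sqrrD !real_normK ?num_real// lerD2r lerDl.
by rewrite mulrn_wge0// mulr_ge0.
Qed.

Lemma gt0_complexE (h : R[i]) : 0 < h -> exists2 e : R, 0 < e & h = e%:C.
Proof.
move=> h0; have hr : h \is Num.real by rewrite gtr0_real.
exists (complex.Re h); last by rewrite RRe_real.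
by rewrite -ltcR RRe_real.
Qed.

Lemma cis_near t0 (e : R) : 0 < e -> \forall t \near t0, `|cis t - cis t0| <= e%:C.
Proof.
move=> e0; have e20 : 0 < e / 2 by rewrite divr_gt0.
have /cvgrPdist_le/(_ _ e20) nc := @continuous_cos R t0.
have /cvgrPdist_le/(_ _ e20) ns := @continuous_sin R t0.
near=> t; apply: le_trans (norm_complex_le _ _) _; rewrite lecR (splitr e).
by apply: lerD; rewrite distrC; near: t.
Unshelve. all: by end_near. Qed.

Variable l : R.
Definition floquet th : 'M[R[i]]_(3 * 3) := symbol l%:C (cis th.1) (cis th.2).

Lemma floquet_herm th : (floquet th) ^t* = floquet th.
Proof. by rewrite symbol_herm ?norm_cis//; apply/complex_realP; exists l. Qed.

Lemma floquet_near th0 (h : R[i]) : 0 < h ->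
  \forall th \near th0, forall i j, `|floquet th i j - floquet th0 i j| <= h.
Proof.
move=> /gt0_complexE[e e0 ->]; have e20 : 0 < e / 2 by rewrite divr_gt0.
case: th0 => a b.
exists ([set t | `|cis t - cis a| <= (e / 2)%:C], [set t | `|cis t - cis b| <= (e / 2)%:C]).
  by split; exact: cis_near.
move=> [x y] /= [hx hy] i j.
apply: le_trans (symbol_lip _ _ _ _ _ _ _) _; rewrite ?norm_cis//=.
by rewrite (splitr e) rmorphD /= lerD.
Qed.

Lemma sub_scalar_herm (mu : R) (M : 'M[R[i]]_(3 * 3)) : M ^t* = M ->
  (M - mu%:C%:M) ^t* = M - mu%:C%:M.
Proof.
move=> Mh; rewrite linearB /= map_mxB Mh tr_scalar_mx map_scalar_mx /=.
by congr (_ - _%:M); apply/CrealP/complex_realP; exists mu.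
Qed.

Lemma entry_shift (M N D : 'M[R[i]]_(3 * 3)) i j :
  (M - D) i j - (N - D) i j = M i j - N i j.
Proof. by rewrite !mxE; ring. Qed.

Lemma floquet_pos_open (mu : R) k th0 :
  pos_ge k (floquet th0 - mu%:C%:M) ->
  \forall th \near th0, pos_ge k (floquet th - mu%:C%:M).
Proof.
move=> /(pos_ge_near (sub_scalar_herm _ (floquet_herm _)))[h h0 near].
apply: filterS (floquet_near th0 h0) => th hth; apply: near.
  exact: sub_scalar_herm (floquet_herm _).
by move=> i j; rewrite entry_shift; exact: hth.
Qed.

Lemma floquet_neg_open (mu : R) k th0 :
  pos_ge k (- (floquet th0 - mu%:C%:M)) ->
  \forall th \near th0, pos_ge k (- (floquet th - mu%:C%:M)).
Proof.
have hermN (M : 'M[R[i]]_(3 * 3)) : M ^t* = M -> (- M) ^t* = - M.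
  by move=> Mh; rewrite linearN map_mxN /= Mh.
have fh th := hermN _ (sub_scalar_herm mu (floquet_herm th)).
move=> /(pos_ge_near (fh _))[h h0 near].
apply: filterS (floquet_near th0 h0) => th hth; apply: near => //.
have entryN (M N : 'M[R[i]]_(3 * 3)) i j : (- M) i j - (- N) i j = - (M i j - N i j).
  by rewrite !mxE; ring.
by move=> i j; rewrite entryN normrN entry_shift; exact: hth.
Qed.

Lemma open_comp_near (P : R * R -> Prop) (p : R -> R * R) :
  (forall t, p @ t --> p t) -> (forall th, P th -> \forall th' \near th, P th') ->
  open [set t | P (p t)].
Proof. by move=> cp oP; rewrite openE => t Pt; exact: (cp t) (oP _ Pt). Qed.

(* The index of [floquet th - mu] is locally constant where it is invertible,
   hence constant along segments. *)
Lemma floquet_index_const (mu : R) k th th' :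
  (forall th, floquet th - mu%:C%:M \in unitmx) ->
  pos_ge k (floquet th - mu%:C%:M) -> (k <= 9)%N ->
  pos_ge k (floquet th' - mu%:C%:M).
Proof.
move=> inv pk k9.
pose p (t : R) : R * R := (th.1 + t * (th'.1 - th.1), th.2 + t * (th'.2 - th.2)).
have aff (a b t : R) : a + x * b @[x --> t] --> a + t * b.
  by apply: cvgD; [exact: cvg_cst|apply: cvgMr_tmp; exact: cvg_id].
have cp t : p @ t --> p t by apply: (@cvg_pair _ _ _ (nbhs t) (nbhs (p t).1) (nbhs (p t).2)); exact: aff.
pose B : set R := [set t | pos_ge k (floquet (p t) - mu%:C%:M)].
pose B' : set R := [set t | pos_ge ((3 * 3).+1 - k)%N (- (floquet (p t) - mu%:C%:M))].
have BB' : ~` B = B'.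
  apply/seteqP; split => t /= Bt.
    case: (pos_geVneg k (sub_scalar_herm mu (floquet_herm (p t))) (inv (p t))) => h.
      by case: (Bt h).
    exact: h.
  move=> Bt'; have := pos_ge_le Bt' Bt.
  move: k9; clear; lia.
have oB : open B.
  exact: (open_comp_near (P := fun th => pos_ge k (floquet th - mu%:C%:M))
    cp (@floquet_pos_open mu k)).
have oB' : open B'.
  exact: (open_comp_near
    (P := fun th => pos_ge ((3 * 3).+1 - k)%N (- (floquet th - mu%:C%:M)))
    cp (@floquet_neg_open mu _)).
have : connected [set: R] by apply/connected_intervalP.
move=> /(_ B) conn; have p0 : p 0 = th.
  by rewrite /p !mul0r !addr0; case: (th).
have p1 : p 1 = th'.
  by rewrite /p !mul1r ![_ + (_ - _)]addrC !subrK; case: (th').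
have B0 : B 0 by rewrite /B /= p0.
have BT : B = setT.
  apply: conn; first by exists 0.
    by exists B; [exact: oB|exact: esym (setTI B)].
  exists B; last exact: esym (setTI B).
  by rewrite -[B]setCK; apply: open_closedC; rewrite BB'; exact: oB'.
have B1 : B 1 by rewrite BT; exact: I.
by rewrite /B /= p1 in B1; exact: B1.
Qed.

(** [sqnorm_lower_near] gives a constant near each momentum, and compactness of the square of
    momenta makes it uniform. *)
Lemma floquet_lower_bound (mu : R[i]) :
  (forall th, floquet th - mu%:M \in unitmx) ->
  exists2 e : R, 0 < e & forall s t, 0 <= s <= pi *+ 2 -> 0 <= t <= pi *+ 2 ->
    forall v, e%:C * sqnorm v <= sqnorm (v *m (floquet (s, t) - mu%:M)).
Proof.
move=> inv; pose P (e : R) (th : R * R) := forall v,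
  e%:C * sqnorm v <= sqnorm (v *m (floquet th - mu%:M)).
have cK : compact (`[0, pi *+ 2] `*` `[0, pi *+ 2] : set (R * R)).
  by apply: compact_setX; exact: segment_compact.
have near0 : \forall e \near 0^'+, `[0, pi *+ 2] `*` `[0, pi *+ 2] `<=` P e.
  apply: (iffLR (compact_near_coveringP _) cK R) => th _.
  have [h h0 [e e0 near]] := sqnorm_lower_near (inv th).
  have [d d0 eE] := gt0_complexE e0.
  exists ([set th' | forall i j, `|floquet th' i j - floquet th i j| <= h], [set e' | e' < d]).
    split; first exact: floquet_near.
    exact: nbhs_right_lt.
  move=> [th' e'] /= [hth e'd] v.
  apply: le_trans (near (floquet th' - mu%:M) _ v).
    by rewrite eE ler_wpM2r ?sqnorm_ge0// lecR ltW.
  by move=> i j; rewrite entry_shift; exact: hth.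
near (0 : R)^'+ => e.
have eP : `[0, pi *+ 2] `*` `[0, pi *+ 2] `<=` P e by near: e; exact: near0.
have e0 : 0 < e by near: e; exact: nbhs_right_gt.
exists e; first exact: e0.
move=> s t hs ht.
apply: eP.
by split; rewrite /= in_itv.
Unshelve. all: by end_near. Qed.

End Torus.

Lemma rmorph_gap_resultant (K L : pzRingType) (f : {rmorphism K -> L}) (l s t : K) :
  f (gap_resultant l s t) = gap_resultant (f l) (f s) (f t).
Proof.
by rewrite /gap_resultant !(rmorphD, rmorphN, rmorphM, rmorphXn, rmorph_nat).
Qed.

(* Otherwise unification unfolds the 9 x 9 matrix. *)
Local Opaque symbol.

Section FloquetSpectrum.
Variables (R : realType) (l : R).
Implicit Types (th : R * R) (mu : R).
Local Notation floquet := (floquet l).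

Lemma cis_cube_real t : exists2 s : R, 0 <= s &
  2 - cis t ^+ 3 - cis t ^- 3 = s%:C.
Proof.
have w1 : `|cis t ^+ 3| = 1 by rewrite normrX norm_cis expr1n.
exists (2 - 2 * complex.Re (cis t ^+ 3)).
  have := normc_ge_Re (cis t ^+ 3); rewrite w1 -[1]/(1%:C) lecR.
  by rewrite ler_norml => /andP[_]; lra.
rewrite -addrA -opprD; move: (_ ^+ 3) w1 => w w1.
rewrite -(norm1_conj w1) [w + _]addcJ rmorphB rmorphM /=.
by rewrite !rmorph_nat.
Qed.

Lemma not_unitmx_kerP n (M : 'M[R[i]]_n) :
  reflect (exists2 v : 'rV_n, v != 0 & v *m M = 0) (M \notin unitmx).
Proof.
rewrite -row_free_unit -kermx_eq0; apply: (iffP rowV0Pn).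
  by move=> [v vM v0]; exists v => //; exact/sub_kermxP.
by move=> [v v0 vM]; exists v => //; exact/sub_kermxP.
Qed.

Lemma not_unitmx_eigenvector n (M : 'M[R[i]]_n) a : M - a%:M \notin unitmx ->
  exists2 v : 'rV_n, v != 0 & v *m M = a *: v.
Proof.
move=> /not_unitmx_kerP[v v0 vM]; exists v => //.
by move/eqP: vM; rewrite mulmxBr mul_mx_scalar subr_eq0 => /eqP.
Qed.

Lemma pos_ge_shift n k (M : 'M[R[i]]_n) c : pos_ge k M -> 0 <= c ->
  pos_ge k (M + c%:M).
Proof.
move=> [U rU [e e0 Ue]] c0; exists U => //; exists e => // v /Ue h.
by rewrite qformD qform_scalar (le_trans h)// lerDl mulr_ge0// sqnorm_ge0.
Qed.

Lemma pos_ge1 (M : 'M[R[i]]_(3 * 3)) mu mu' : M - mu'%:C%:M \notin unitmx ->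
  mu < mu' -> pos_ge 1 (M - mu%:C%:M).
Proof.
move=> /not_unitmx_eigenvector[v v0 vM] h.
apply: (@pos_ge_eigenvector _ _ _ v (mu' - mu)%:C) => //.
  by rewrite -[0]/(0%:C) ltcR subr_gt0.
by rewrite mulmxBr vM mul_mx_scalar -scalerBl rmorphB.
Qed.

Lemma neg_ge1 (M : 'M[R[i]]_(3 * 3)) mu mu' : M - mu'%:C%:M \notin unitmx ->
  mu' < mu -> pos_ge 1 (- (M - mu%:C%:M)).
Proof.
move=> /not_unitmx_eigenvector[v v0 vM] h.
apply: (@pos_ge_eigenvector _ _ _ v (mu - mu')%:C) => //.
  by rewrite -[0]/(0%:C) ltcR subr_gt0.
by rewrite opprB mulmxBr vM mul_mx_scalar -scalerBl rmorphB.
Qed.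

Lemma floquet_unit0 : 0 < l -> l <= 4 / 9 -> forall th, floquet th \in unitmx.
Proof.
move=> l0 l49 th; case: (boolP (floquet th \in unitmx)) => // /not_unitmx_kerP[v v0].
rewrite -[v]vec_mxK mxvec_symbol => /(congr1 vec_mx); rewrite mxvecK linear0.
have [s s0 sE] := cis_cube_real th.1; have [t t0 tE] := cis_cube_real th.2.
move=> /symbol_op_inj; rewrite sE tE !cis_neq0 => /(_ isT isT) h.
move: v0; rewrite -[v]vec_mxK h ?linear0 ?eqxx//.
rewrite -(rmorph_gap_resultant (real_complex R)).
by rewrite -[0]/(0%:C) (inj_eq (@complexI _)) gt_eqF// gap_resultant_gt0.
Qed.

(* In the variable [mu = E + 1]. *)
Definition floquet_spectrum : set R :=
  [set mu | exists th, floquet th - mu%:C%:M \notin unitmx].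

Lemma notin_floquet_spectrum mu : ~ floquet_spectrum mu ->
  forall th, floquet th - mu%:C%:M \in unitmx.
Proof.
move=> nmu th; case: (boolP (floquet th - mu%:C%:M \in unitmx)) => // h.
by case: nmu; exists th.
Qed.

Let F00 : floquet (0, 0) = symbol l%:C 1 1.
Proof. exact: (congr2 (symbol l%:C) (cis0 R) (cis0 R)). Qed.
Let F0pi : floquet (0, pi) = symbol l%:C 1 (-1).
Proof. exact: (congr2 (symbol l%:C) (cis0 R) (cispi R)). Qed.
Let Fpipi : floquet (pi, pi) = symbol l%:C (-1) (-1).
Proof. exact: (congr2 (symbol l%:C) (cispi R) (cispi R)). Qed.

Lemma index_contra mu k m th th' : ~ floquet_spectrum mu -> (k <= 9)%N ->
  pos_ge k (floquet th - mu%:C%:M) -> pos_ge m (- (floquet th' - mu%:C%:M)) ->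
  (k + m <= 9)%N.
Proof.
move=> /notin_floquet_spectrum inv k9 pk pm.
exact: (pos_ge_le (floquet_index_const th' inv pk k9) pm).
Qed.

Hypothesis l_gt0 : 0 < l.
Hypothesis l_le : l <= 4 / 9.
Let l0 : 0 <= l%:C. Proof. by rewrite ler0c ltW. Qed.
Let natC n : n%:R = (n%:R : R)%:C. Proof. by rewrite rmorph_nat. Qed.

Let pos11 mu : mu < - l -> pos_ge 9 (floquet (0, 0) - mu%:C%:M).
Proof.
rewrite F00 -ltcR raddfN => h.
exact: pos_ge_11 l0 h.
Qed.

Let neg11 mu : l < mu -> pos_ge 8 (- (floquet (0, 0) - mu%:C%:M)).
Proof.
rewrite F00 -ltcR => h.
exact: neg_ge_11 l0 h.
Qed.

Let pos1N1 mu : mu < 6 - l -> pos_ge 2 (floquet (0, pi) - mu%:C%:M).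
Proof.
rewrite F0pi -ltcR raddfB /= -natC => h.
exact: pos_ge_1N1 l0 h.
Qed.

Let negN1N1_all mu : 4 + l < mu -> pos_ge 9 (- (floquet (pi, pi) - mu%:C%:M)).
Proof.
rewrite Fpipi -ltcR raddfD /= -natC => h.
exact: neg_ge_N1N1 l0 h.
Qed.

Let posN1N1 mu : mu < 1 - l -> pos_ge 5 (floquet (pi, pi) - mu%:C%:M).
Proof.
rewrite Fpipi -ltcR raddfB => h.
exact: pos_ge_N1N1 l0 h.
Qed.

Let negN1N1 mu : - 2 + l < mu -> pos_ge 4 (- (floquet (pi, pi) - mu%:C%:M)).
Proof.
rewrite Fpipi -ltcR raddfD raddfN /= -natC => h.
exact: neg4_ge_N1N1 l0 h.
Qed.

Let subC0 (M : 'M[R[i]]_(3 * 3)) : M - (0 : R)%:C%:M = M.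
Proof. by apply/matrixP => i j; rewrite !mxE mul0rn subr0. Qed.

Lemma floquet_spectrum0 : ~ floquet_spectrum 0.
Proof. by move=> [th]; rewrite subC0 floquet_unit0. Qed.

(** Since 4 + l < 5 < 6 - l, at least two eigenvalues exceed 5 at (0, pi) and none does at (pi, pi),
    so some eigenvalue crosses 5 in between. *)
Lemma floquet_spectrum5 : floquet_spectrum 5.
Proof.
apply: contrapT => h; have hl := l_le.
suff : (2 + 9 <= 9)%N by [].
by apply: (@index_contra _ 2 9 _ _ h isT (pos1N1 _) (negN1N1_all _)); lra.
Qed.

(** Since - 2 + l < -1 < - l, all nine eigenvalues exceed -1 at (0, 0), while at least four lie
    below it at (pi, pi). *)
Lemma floquet_spectrumN1 : floquet_spectrum (-1).
Proof.
apply: contrapT => h; have hl := l_le.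
suff : (9 + 4 <= 9)%N by [].
by apply: (@index_contra _ 9 4 _ _ h isT (pos11 _) (negN1N1 _)); lra.
Qed.

(** The signature (5, 4) is read off at (pi, pi) and carried to every momentum through the gap. *)
Let index0 th : pos_ge 5 (floquet th) /\ pos_ge 4 (- floquet th).
Proof.
have hl := l_le; have hl0 := l_gt0.
have inv := notin_floquet_spectrum floquet_spectrum0.
have p5 : pos_ge 5 (floquet th).
  by rewrite -(subC0 (floquet th)); apply: (floquet_index_const th inv (posN1N1 _) isT); lra.
split; first exact: p5.
case: (pos_geVneg 6 (floquet_herm l th) (floquet_unit0 l_gt0 l_le th)) => [p6|p4]; last exact: p4.
exfalso; suff : (6 + 4 <= 9)%N by [].
rewrite -(subC0 (floquet th)) in p6.
by apply: (@index_contra _ 6 4 _ _ floquet_spectrum0 isT p6 (negN1N1 _)); lra.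
Qed.

Let shiftE (M : 'M[R[i]]_(3 * 3)) mu nu :
  M - mu%:C%:M = (M - nu%:C%:M) + (nu - mu)%:C%:M.
Proof. by rewrite rmorphB raddfB /= addrA subrK. Qed.

Let pos_geB k (M : 'M[R[i]]_(3 * 3)) mu nu : mu <= nu ->
  pos_ge k (M - nu%:C%:M) -> pos_ge k (M - mu%:C%:M).
Proof.
move=> h pM; rewrite (shiftE M mu nu); apply: (pos_ge_shift pM).
by rewrite -[0]/(0%:C) lecR subr_ge0.
Qed.

Let neg_geB k (M : 'M[R[i]]_(3 * 3)) mu nu : nu <= mu ->
  pos_ge k (- (M - nu%:C%:M)) -> pos_ge k (- (M - mu%:C%:M)).
Proof.
move=> h pM.
rewrite (_ : - (M - _) = - (M - nu%:C%:M) + (mu - nu)%:C%:M); last first.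
  by apply/matrixP => i j; rewrite !mxE rmorphB mulrnBl; ring.
apply: (pos_ge_shift pM).
by rewrite -[0]/(0%:C) lecR subr_ge0.
Qed.

(** At the momentum where [mu1] is an eigenvalue, five directions above [mu] and the four below 0
    would leave no room for the kernel at [mu1]: 5 + 4 + 1 > 9. *)
Let neg5 mu1 mu : floquet_spectrum mu1 -> 0 < mu1 -> mu1 < mu ->
  ~ floquet_spectrum mu -> exists th, pos_ge 5 (- (floquet th - mu%:C%:M)).
Proof.
move=> [th nu1] m0 m1 /notin_floquet_spectrum/(_ th) u; exists th.
have herm nu := sub_scalar_herm nu (floquet_herm l th).
case: (pos_geVneg 5 (herm mu) u) => [p5|]; last exact.
have p5' := pos_geB (ltW m1) p5.
have [_ n4] := index0 th; rewrite -(subC0 (floquet th)) in n4.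
have n4' := neg_geB (ltW m0) n4.
by exfalso; have := pos_ge_ker_lt p5' n4' (herm _) nu1.
Qed.

(** Mirror image of [neg5]: the five directions above 0 and the kernel at [mu2] leave at most three
    directions below [mu]. *)
Let pos6 mu2 mu : floquet_spectrum mu2 -> mu2 < 0 -> mu < mu2 ->
  ~ floquet_spectrum mu -> exists th, pos_ge 6 (floquet th - mu%:C%:M).
Proof.
move=> [th nu1] m0 m1 /notin_floquet_spectrum/(_ th) u; exists th.
have herm nu := sub_scalar_herm nu (floquet_herm l th).
case: (pos_geVneg 6 (herm mu) u) => [|n4]; first exact.
have n4' := neg_geB (ltW m1) n4.
have [p5 _] := index0 th; rewrite -(subC0 (floquet th)) in p5.
have p5' := pos_geB (ltW m0) p5.
by exfalso; have := pos_ge_ker_lt p5' n4' (herm _) nu1.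
Qed.

(** Below [1 - l] the count of [neg5] is contradicted at (pi, pi); up to [6 - l], (0, pi) and (0, 0)
    contradict each other; above that, (pi, pi) contradicts the eigenvalue [mu2]. The ranges cover
    everything because l < 1 - l and 4 + l < 6 - l. *)
Lemma floquet_spectrum_pos_interval mu1 mu mu2 :
  floquet_spectrum mu1 -> floquet_spectrum mu2 -> 0 < mu1 -> mu1 < mu -> mu < mu2 ->
  floquet_spectrum mu.
Proof.
move=> s1 s2 m10 m1 m2; have hl := l_le; apply: contrapT => h.
have [th2 u2] := s2; have p1 := pos_ge1 u2 m2; have [th1 n5] := neg5 s1 m10 m1 h.
have [lmu|lmu] := ltrP mu (1 - l).
  suff : (5 + 5 <= 9)%N by [].
  exact: (@index_contra _ 5 5 _ _ h isT (posN1N1 lmu) n5).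
have [mu6|mu6] := ltrP mu (6 - l).
  suff : (2 + 8 <= 9)%N by [].
  by apply: (@index_contra _ 2 8 _ _ h isT (pos1N1 mu6) (neg11 _)); lra.
suff : (1 + 9 <= 9)%N by [].
by apply: (@index_contra _ 1 9 _ _ h isT p1 (negN1N1_all _)); lra.
Qed.

Lemma floquet_spectrum_neg_interval mu1 mu mu2 :
  floquet_spectrum mu1 -> floquet_spectrum mu2 -> mu2 < 0 -> mu1 < mu -> mu < mu2 ->
  floquet_spectrum mu.
Proof.
move=> s1 s2 m20 m1 m2; have hl := l_le; apply: contrapT => h.
have [th1 u1] := s1; have n1 := neg_ge1 u1 m1; have [th2 p6] := pos6 s2 m20 m2 h.
have [lmu|lmu] := ltrP (- 2 + l) mu.
  suff : (6 + 4 <= 9)%N by [].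
  exact: (@index_contra _ 6 4 _ _ h isT p6 (negN1N1 lmu)).
suff : (9 + 1 <= 9)%N by [].
by apply: (@index_contra _ 9 1 _ _ h isT (pos11 _) n1); lra.
Qed.

End FloquetSpectrum.

(** * Discrete Floquet transform *)

Definition zbox (L : nat) : seq int := [seq i%:Z - L%:Z | i <- iota 0 (2 * L).+1].
Definition box (L : nat) : seq (int * int) := [seq (a, b) | a <- zbox L, b <- zbox L].

Lemma mem_zbox L a : (a \in zbox L) = (`|a|%N <= L)%N.
Proof.
apply/mapP/idP => [[m]|aL]; first by rewrite mem_iota => ? ->; lia.
exists (absz (a + L%:Z)); first by rewrite mem_iota; lia.
lia.
Qed.

Lemma zbox_uniq L : uniq (zbox L).
Proof. by rewrite map_inj_uniq ?iota_uniq// => i j; lia. Qed.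

Lemma mem_box L n : (n \in box L) = (`|n.1|%N <= L)%N && (`|n.2|%N <= L)%N.
Proof.
case: n => a b; apply/allpairsP/andP => /=.
  by move=> [ [c d] /= [+ + [-> ->]]]; rewrite !mem_zbox.
by rewrite -!mem_zbox => -[? ?]; exists (a, b).
Qed.

Lemma box_uniq L : uniq (box L).
Proof. by apply: allpairs_uniq; rewrite ?zbox_uniq// => -[? ?] [? ?]. Qed.

Section Supports.
Variable V : nmodType.
Implicit Types (g : int * int -> V).

Definition supported (K : nat) g := forall n, n \notin box K -> g n = 0.

Lemma eq_sum_supp (s s' : seq (int * int)) g : uniq s -> uniq s' ->
  (forall n, g n != 0 -> (n \in s) && (n \in s')) ->
  \sum_(n <- s) g n = \sum_(n <- s') g n.
Proof.
move=> us us' gs; rewrite (bigID (fun n => g n == 0)) /= big1 ?add0r; last by move=> n /eqP.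
rewrite [RHS](bigID (fun n => g n == 0)) /= [X in _ = X + _]big1 ?add0r; last by move=> n /eqP.
rewrite -big_filter -[RHS]big_filter; apply: perm_big.
apply: uniq_perm; rewrite ?filter_uniq// => n; rewrite !mem_filter.
by case: (boolP (g n == 0)) => //= /gs /andP[-> ->].
Qed.

Lemma sum_box_shift K L g d : supported K g -> (K + 1 <= L)%N ->
  (`|d.1|%N <= 1)%N -> (`|d.2|%N <= 1)%N ->
  \sum_(n <- box L) g (n + d) = \sum_(n <- box L) g n.
Proof.
move=> sg KL d1 d2; rewrite -[LHS](big_map (fun n => n + d) xpredT g).
apply: eq_sum_supp; rewrite ?map_inj_uniq ?box_uniq//; first exact: addIr.
move=> n gn; have nK : n \in box K by apply: contraNT gn => /sg ->.
rewrite mem_box in nK; apply/andP; split; last by rewrite mem_box; lia.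
apply/mapP; exists (n - d); last by rewrite subrK.
move: nK d1 d2 KL; rewrite mem_box; clear; case: n => a b; case: d => c e /=.
lia.
Qed.

End Supports.

Section Transform.
Variable R : realType.
Implicit Types (f : int * int -> R[i]) (th : R * R).
Local Notation Z2 := (int * int)%type.

Definition character th (n : Z2) : R[i] := cis (n.1%:~R * th.1 + n.2%:~R * th.2).

Lemma characterD th n m : character th (n + m) = character th n * character th m.
Proof.
rewrite /character -cisD; congr cis; case: n m => a b [c d].
by rewrite -[(a, b) + _]/(a + c, b + d) /= !rmorphD /=; ring.
Qed.

Lemma character_norm th n : `|character th n| = 1.
Proof. exact: norm_cis. Qed.

Definition residue (n : Z2) : 'I_3 * 'I_3 := ((n.1%:~R : 'Z_3), (n.2%:~R : 'Z_3)).

Lemma residueD n m : residue (n + m) = residue n + residue m.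
Proof.
case: n m => a b [c d]; rewrite -[(a, b) + _]/(a + c, b + d) /residue /=.
by rewrite !rmorphD.
Qed.

(** One Fourier sum per residue class modulo 3. The box keeps the sum finite and loses nothing for
    [f] supported in it. The phase is that of the site and not of its cell, in accordance with the
    phases on all bonds in [hop]. *)
Definition transform L f th : 'M[R[i]]_3 :=
  \matrix_(j, k) \sum_(n <- box L) (residue n == (j, k))%:R * f n * character th n.

Lemma transform_shift K L f th d : supported K f -> (K + 1 <= L)%N ->
  (`|d.1|%N <= 1)%N -> (`|d.2|%N <= 1)%N -> forall j k,
  transform L (fun n => f (n + d)) th j k =
  character th (- d) * transform L f th (j + (residue d).1) (k + (residue d).2).
Proof.
move=> sf KL d1 d2 j k; rewrite !mxE mulr_sumr.
rewrite -(@sum_box_shift _ K L (fun n => character th (- d) *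
  ((residue n == (j + (residue d).1, k + (residue d).2))%:R * f n * character th n)) d)//; last first.
  by move=> n /sf ->; rewrite mulr0 mul0r mulr0.
apply: eq_bigr => n _.
have -> : (j + (residue d).1, k + (residue d).2) = (j, k) + residue d by case: (residue d).
rewrite residueD (inj_eq (addIr _)) [in RHS]mulrCA -characterD.
by rewrite [- d + _]addrC addrK.
Qed.

Lemma transformD L f g th : transform L (f + g) th = transform L f th + transform L g th.
Proof.
apply/matrixP => j k; rewrite !mxE -big_split; apply: eq_bigr => n _ /=.
by rewrite -[(f + g) n]/(f n + g n); ring.
Qed.

Lemma transformZ L c f th : transform L (c *: f) th = c *: transform L f th.
Proof.
apply/matrixP => j k; rewrite !mxE mulr_sumr; apply: eq_bigr => n _ /=.
by rewrite -[(c *: f) n]/(c * f n); ring.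
Qed.

End Transform.

(** * The operator in Floquet variables *)

Section Operator.
Variable R : realType.
Implicit Types (f : int * int -> R[i]) (th : R * R) (l : R) (mu : R[i]).
Local Notation Z2 := (int * int)%type.

Definition line_sign (m : int) : R := if (m%:~R : 'Z_3) == 0 then -1 else 1.
Definition gap_potential (n : Z2) : R := line_sign n.1 * line_sign n.2.

(** The offset 0 turns the neighbour sum into A (x) A, so [mu] is the energy plus one. The operator
    acts on arbitrary functions, hence also on Bloch waves and on pointwise limits. *)
Definition schrodinger l mu f (n : Z2) : R[i] :=
  \sum_(d <- 0 :: ehm_offsets) f (n + d) + (l * gap_potential n)%:C * f n - mu * f n.

Lemma cisN (t : R) : cis (- t) = (cis t)^-1.
Proof.
apply: (mulIf (cis_neq0 t)); rewrite mulVf ?cis_neq0// -cisD addNr.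
exact: cis0.
Qed.

Lemma sum_I3 (V : nmodType) (G : 'I_3 -> V) (j : 'I_3) :
  \sum_i G i = G j + G (j + 1) + G (j - 1).
Proof.
rewrite !big_ord_recl big_ord0 addr0.
case: j => [[|[|[|//]]] hj].
- by rewrite [LHS]addrA; congr (G _ + G _ + G _); exact: val_inj.
- by rewrite [LHS]addrC; congr (G _ + G _ + G _); exact: val_inj.
- by rewrite [LHS]addrA [LHS]addrC [LHS]addrA; congr (G _ + G _ + G _); exact: val_inj.
Qed.

Lemma hop_diag (z : R[i]) j : hop z j j = 1.
Proof. by rewrite mxE eqxx. Qed.

Lemma hop_succ (z : R[i]) j : hop z j (j + 1) = z^-1.
Proof. by rewrite mxE eqxx; case: j => [[|[|[|//]]] hj]. Qed.

Lemma hop_pred (z : R[i]) j : hop z j (j - 1) = z.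
Proof. by rewrite mxE; case: j => [[|[|[|//]]] hj]. Qed.

Lemma hop_conjugate_apply (z w : R[i]) (X : 'M[R[i]]_3) j k :
  (hop z *m X *m (hop w)^T) j k =
    X j k + z^-1 * X (j + 1) k + z * X (j - 1) k
  + w^-1 * (X j (k + 1) + z^-1 * X (j + 1) (k + 1) + z * X (j - 1) (k + 1))
  + w * (X j (k - 1) + z^-1 * X (j + 1) (k - 1) + z * X (j - 1) (k - 1)).
Proof.
have E i : (hop z *m X) j i = X j i + z^-1 * X (j + 1) i + z * X (j - 1) i.
  by rewrite mxE (sum_I3 _ j) hop_diag hop_succ hop_pred mul1r.
rewrite mxE (sum_I3 _ k) !E; have T a b : (hop w)^T a b = hop w b a by rewrite mxE.
by rewrite !T hop_diag hop_succ hop_pred mulr1 ![_ * w^-1]mulrC ![_ * w]mulrC.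
Qed.

Lemma transform_gap_potential l L f th j k :
  transform L (fun n => (l * gap_potential n)%:C * f n) th j k =
  l%:C * (sgnmx _ *m transform L f th *m sgnmx _) j k.
Proof.
have -> (X : 'M[R[i]]_3) : (sgnmx _ *m X *m sgnmx _) j k =
    site_sign _ j * site_sign _ k * X j k.
  by rewrite mul_mx_diag mxE mul_diag_mx !mxE mulrAC.
rewrite !mxE !mulr_sumr; apply: eq_bigr => n _.
case: eqP => [nE|_]; last by rewrite !mul0r !mulr0.
rewrite /gap_potential; move: nE; case: n => a b; case=> <- <- /=.
have sE m : (line_sign m)%:C = site_sign R[i] (m%:~R : 'Z_3).
  by rewrite /line_sign /site_sign; case: ifP => _; rewrite ?rmorphN rmorph1.
by rewrite !rmorphM /= !sE /= !mul1r !mulrA.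
Qed.

Lemma schrodinger_expand l mu f : schrodinger l mu f =
  (fun n => f (n + 0)) + (fun n => f (n + (1, 0))) + (fun n => f (n + (-1, 0)))
  + (fun n => f (n + (0, 1))) + (fun n => f (n + (0, -1)))
  + (fun n => f (n + (1, 1))) + (fun n => f (n + (1, -1)))
  + (fun n => f (n + (-1, 1))) + (fun n => f (n + (-1, -1)))
  + (fun n => (l * gap_potential n)%:C * f n) + (- mu) *: f.
Proof.
apply/funext => n; rewrite /schrodinger /ehm_offsets !big_cons big_nil addr0.
by rewrite !(addrfctE, scalrfctE) scaleNr !addrA !addr0.
Qed.

Lemma characterE th a b : character th (a, b) = cis (a%:~R * th.1) * cis (b%:~R * th.2).
Proof. by rewrite -cisD. Qed.

(** The nine terms of the tensor product of 1 + shift + shift^-1 with itself are the site and its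
    eight neighbours. *)
Lemma hop_conjugate_sum th (X : 'M[R[i]]_3) j k :
  (hop (cis th.1) *m X *m (hop (cis th.2))^T) j k =
  \sum_(d <- 0 :: ehm_offsets)
    character th (- d) * X (j + (residue d).1) (k + (residue d).2).
Proof.
rewrite hop_conjugate_apply /ehm_offsets !big_cons big_nil.
have rE (d : Z2) a b : residue d = (a, b) -> (residue d).1 = a /\ (residue d).2 = b by move=> ->.
have [-> ->] := rE 0 0 0 erefl.
have [-> ->] := rE (1, 0) 1 0 erefl; have [-> ->] := rE (-1, 0) (-1) 0 erefl.
have [-> ->] := rE (0, 1) 0 1 erefl; have [-> ->] := rE (0, -1) 0 (-1) erefl.
have [-> ->] := rE (1, 1) 1 1 erefl; have [-> ->] := rE (1, -1) 1 (-1) erefl.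
have [-> ->] := rE (-1, 1) (-1) 1 erefl; have [-> ->] := rE (-1, -1) (-1) (-1) erefl.
rewrite !addr0 oppr0.
have cE (a b : int) : character th (- (a, b)) = cis (- (a%:~R * th.1)) * cis (- (b%:~R * th.2)).
  by rewrite -[- (a, b)]/(- a, - b) characterE !rmorphN !mulNr.
rewrite -[0 : Z2]/(0, 0) characterE !cE !mulrN1z !mul0r !mul1r !mulN1r.
rewrite !opprK oppr0 !cisN.
have c0 : cis (0 : R) = 1 by exact: cis0.
rewrite !c0; ring.
Qed.

Lemma transform_schrodinger l mu K L f th : supported K f -> (K + 1 <= L)%N ->
  transform L (schrodinger l mu f) th =
  symbol_op l%:C (cis th.1) (cis th.2) (transform L f th) - mu *: transform L f th.
Proof.
move=> sf KL; rewrite schrodinger_expand !transformD transformZ scaleNr.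
apply/matrixP => j k.
have mD (A B : 'M[R[i]]_3) : (A + B) j k = A j k + B j k by rewrite mxE.
have mZ c (A : 'M[R[i]]_3) : (c *: A) j k = c * A j k by rewrite mxE.
rewrite !mD transform_gap_potential !(transform_shift _ sf KL)// mZ.
congr (_ + _ + _).
by rewrite hop_conjugate_sum /ehm_offsets !big_cons big_nil; ring.
Qed.

End Operator.

(** * Parseval's identity on a finite grid of momenta *)

Section Parseval.
Variable R : realType.
Implicit Types (f : int * int -> R[i]) (t : R).
Local Notation Z2 := (int * int)%type.

Lemma cis_exp t n : cis (n%:R * t) = cis t ^+ n.
Proof.
elim: n => [|n IHn]; first by rewrite mul0r expr0; exact: cis0.
by rewrite exprS -IHn -cisD -natr1 mulrDl mul1r addrC.
Qed.

Lemma cis_2pi (k : int) : cis (k%:~R * (pi *+ 2)) = 1 :> R[i].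
Proof.
have c1 : cis (pi *+ 2 : R) = 1 by rewrite /cis cos2pi sin2pi.
case: k => n; first by rewrite -pmulrn cis_exp c1 expr1n.
by rewrite NegzE mulrNz mulNr cisN -pmulrn cis_exp c1 expr1n invr1.
Qed.

Lemma cis_neq1 t : 0 < t < pi *+ 2 -> cis t != 1.
Proof.
move=> /andP[t0 tpi]; apply/eqP => c1.
have : complex.Re (cis t) = 1 by rewrite c1.
rewrite /= (_ : t = (t / 2) *+ 2); last by rewrite -mulr_natr mulfVK.
have s0 : 0 < sin (t / 2) by rewrite sin_gt0_pi// divr_gt0//= ltr_pdivrMr// mulr_natr.
rewrite cos_mulr2n cos2sin2 mulrnBl => h.
have : sin (t / 2) ^+ 2 = 0 by move: (sin _ ^+ 2) h => x; lra.
by move/eqP; rewrite sqrf_eq0 gt_eqF.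
Qed.

Definition grid N (a : nat) : R := a%:R * (pi *+ 2 / N%:R).

Lemma grid_bounds N a : (a < N)%N -> 0 <= grid N a <= pi *+ 2.
Proof.
move=> aN; have N0 : 0 < N%:R :> R by rewrite ltr0n; lia.
have p0 : 0 <= pi *+ 2 :> R by rewrite mulrn_wge0// pi_ge0.
rewrite mulr_ge0 ?divr_ge0//= /grid.
by rewrite mulrCA ler_piMr// ler_pdivrMr// mul1r ler_nat ltnW.
Qed.

Lemma sum_cis_grid N (k : int) : (`|k|%N < N)%N ->
  \sum_(a < N) cis (k%:~R * grid N a) = (N * (k == 0))%:R :> R[i].
Proof.
move=> kN; have N0 : 0 < N%:R :> R by rewrite ltr0n; lia.
case: eqP => [->|k0].
  under eq_bigr do rewrite mul0r; rewrite [cis 0](cis0 R) sumr_const card_ord muln1//.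
rewrite muln0; pose q : R[i] := cis (k%:~R * (pi *+ 2 / N%:R)).
have qE a : cis (k%:~R * grid N a) = q ^+ a.
  by rewrite -cis_exp /grid mulrCA.
under eq_bigr do rewrite qE.
have qN : q ^+ N = 1.
  rewrite -cis_exp -(cis_2pi k); congr cis.
  by field; exact: lt0r_neq0.
have q1 : q != 1.
  have pos (m : nat) : (0 < m < N)%N -> cis (m%:R * (pi *+ 2 / N%:R)) != 1 :> R[i].
    move=> /andP[m0 mN]; have pp : 0 < pi *+ 2 :> R by rewrite mulrn_wgt0// pi_gt0.
    apply: cis_neq1; rewrite mulr_gt0 ?ltr0n ?divr_gt0//=.
    by rewrite mulrCA gtr_pMr// ltr_pdivrMr// mul1r ltr_nat.
  rewrite /q; case: (k) kN k0 => m kN k0; first by rewrite -pmulrn pos//; lia.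
  rewrite NegzE mulrNz mulNr cisN -pmulrn invr_eq1 pos//; lia.
apply: (mulfI (_ : q - 1 != 0)); first by rewrite subr_eq0.
by rewrite -subrX1 qN subrr mulr0.
Qed.

Lemma character_conj th n : (character th n)^* = character th (- n) :> R[i].
Proof.
rewrite norm1_conj ?character_norm//.
rewrite -[RHS]mul1r -(@mulVf _ (character th n)) ?cis_neq0// -mulrA -characterD addrN.
rewrite /character /= !mul0r addr0; have -> : cis (0 : R) = 1 by exact: cis0.
by rewrite mulr1.
Qed.

Lemma sum_character_grid N (n : Z2) : (`|n.1|%N < N)%N -> (`|n.2|%N < N)%N ->
  \sum_(a < N) \sum_(b < N) character (grid N a, grid N b) n =
  ((N ^ 2) * (n == 0))%:R :> R[i].
Proof.
case: n => n m /= nN mN.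
under eq_bigr do under eq_bigr do rewrite characterE /=.
under eq_bigr do rewrite -mulr_sumr.
rewrite -mulr_suml !sum_cis_grid// -natrM -[0 : Z2]/(0, 0) xpair_eqE.
by congr _%:R; case: (n == 0); case: (m == 0); rewrite ?muln0 ?muln1 ?mul0n.
Qed.

(** A finite grid can replace the integral over the torus: two sites of the box differ by at most
    [2 * L < N] in each coordinate, so there is no aliasing. *)
Lemma parseval_grid L N (g : Z2 -> R[i]) : (2 * L < N)%N ->
  \sum_(a < N) \sum_(b < N)
    `|\sum_(n <- box L) g n * character (grid N a, grid N b) n| ^+ 2 =
  (N ^ 2)%:R * \sum_(n <- box L) `|g n| ^+ 2.
Proof.
move=> LN.
transitivity (\sum_(n <- box L) \sum_(m <- box L) g n * (g m)^* *
  \sum_(a < N) \sum_(b < N) character (grid N a, grid N b) (n - m)).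
  under [RHS]eq_bigr do under eq_bigr do rewrite mulr_sumr.
  under [RHS]eq_bigr do rewrite exchange_big.
  rewrite [RHS]exchange_big; apply: eq_bigr => a _.
  under [RHS]eq_bigr do under eq_bigr do rewrite mulr_sumr.
  under [RHS]eq_bigr do rewrite exchange_big.
  rewrite [RHS]exchange_big; apply: eq_bigr => b _.
  rewrite normCK rmorph_sum mulr_suml; apply: eq_bigr => n _.
  rewrite mulr_sumr; apply: eq_bigr => m _.
  by rewrite rmorphM /= character_conj characterD; ring.
rewrite mulr_sumr; apply: eq_big_seq => n nL.
rewrite (bigD1_seq n nL (box_uniq L)) /= [X in _ + X]big1_seq ?addr0; last first.
  move=> m /andP[mn mL]; rewrite sum_character_grid.
  - by rewrite subr_eq0 eq_sym (negbTE mn) muln0 mulr0.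
  - by move: nL mL; rewrite !mem_box; case: n {mn} => a b; case: m => c d /=; lia.
  - by move: nL mL; rewrite !mem_box; case: n {mn} => a b; case: m => c d /=; lia.
have N0 : (0 < N)%N by lia.
by rewrite subrr sum_character_grid// eqxx muln1 -normCK mulrC.
Qed.

Lemma parseval_transform L N f : (2 * L < N)%N ->
  \sum_(a < N) \sum_(b < N) sqnorm (mxvec (transform L f (grid N a, grid N b))) =
  (N ^ 2)%:R * \sum_(n <- box L) `|f n| ^+ 2.
Proof.
move=> LN.
transitivity (\sum_(j < 3) \sum_(k < 3) (N ^ 2)%:R *
   \sum_(n <- box L) `|(residue n == (j, k))%:R * f n| ^+ 2).
  under [RHS]eq_bigr do under eq_bigr do rewrite -(parseval_grid _ LN).
  under [RHS]eq_bigr do rewrite exchange_big.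
  rewrite [RHS]exchange_big; apply: eq_bigr => a _.
  under [RHS]eq_bigr do rewrite exchange_big.
  rewrite [RHS]exchange_big; apply: eq_bigr => b _.
  rewrite /sqnorm sum_mxvec; apply: eq_bigr => j _; apply: eq_bigr => k _.
  by rewrite mxvecE mxE.
under eq_bigr do rewrite -mulr_sumr exchange_big.
rewrite -mulr_sumr exchange_big; congr (_ * _); apply: eq_bigr => n _.
under eq_bigr do under eq_bigr do rewrite normrM exprMn.
under eq_bigr do rewrite -mulr_suml.
rewrite -mulr_suml; case: (residue n) => j k.
rewrite (bigD1 j)//= (bigD1 k)//= eqxx normr1 expr1n !big1 ?addr0 ?mul1r//.
  move=> j' jj; rewrite big1// => k' _.
  by rewrite xpair_eqE (eq_sym j) (negbTE jj) normr0 expr0n.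
by move=> k' kk; rewrite xpair_eqE (eq_sym k) (negbTE kk) andbF normr0 expr0n.
Qed.

End Parseval.

(** * Contraction by gradient steps *)

Section MatrixContraction.
Variables (C : numClosedFieldType) (n : nat).
Implicit Types (P N : 'M[C]_n) (v : 'rV[C]_n).

Lemma qformZ a P v : qform (a *: P) v = a * qform P v.
Proof. by rewrite /qform -scalemxAr -scalemxAl mxE. Qed.

Lemma sqnorm_gradient_step t P v : t \is Num.real -> P ^t* = P ->
  sqnorm (v - t *: (v *m P)) = sqnorm v - 2 * t * qform P v + t ^+ 2 * sqnorm (v *m P).
Proof.
move=> /CrealP tr Ph.
have -> : v - t *: (v *m P) = v *m (1%:M - t *: P).
  by rewrite mulmxBr mulmx1 scalemxAr.
rewrite !sqnorm_mulmx.
have -> : (1%:M - t *: P) ^t* = 1%:M - t *: P.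
  rewrite linearB /= map_mxB trmx1 map_mx1; congr (_ - _).
  by rewrite linearZ /= map_mxZ /= tr Ph.
have -> : (1%:M - t *: P) *m (1%:M - t *: P) =
    1%:M - (2 * t) *: P + (t ^+ 2) *: (P *m P ^t*).
  rewrite Ph mulmxBl mul1mx mulmxBr mulmx1.
  rewrite -scalemxAl -scalemxAr scalerA -expr2 opprB addrA.
  by rewrite [LHS]addrAC mulrDl mul1r scalerDl opprD !addrA.
by rewrite qformD qformB !qformZ (qform_scalar 1) mul1r.
Qed.

(** The step [e / k] minimises 1 - 2 t e + t^2 k, the factor obtained from the two bounds, with
    minimum 1 - e^2 / k. *)
Lemma sqnorm_contraction (e k : C) N v : 0 < e -> 0 < k ->
  e * sqnorm v <= sqnorm (v *m N) ->
  sqnorm (v *m (N *m N ^t*)) <= k * sqnorm v ->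
  sqnorm (v - (e / k) *: (v *m (N *m N ^t*))) <= (1 - e ^+ 2 / k) * sqnorm v.
Proof.
move=> e0 k0 lo hi; have ek : 0 < e / k by rewrite divr_gt0.
rewrite sqnorm_gradient_step ?gtr0_real//; last first.
  by rewrite trmx_mul map_mxM trmxCK.
rewrite -sqnorm_mulmx.
have h1 : 2 * (e / k) * (e * sqnorm v) <= 2 * (e / k) * sqnorm (v *m N).
  by rewrite ler_wpM2l// mulr_ge0// ltW.
have h2 : (e / k) ^+ 2 * sqnorm (v *m (N *m N ^t*)) <= (e / k) ^+ 2 * (k * sqnorm v).
  by rewrite ler_wpM2l// exprn_ge0// ltW.
apply: le_trans (lerD (lerB (lexx (sqnorm v)) h1) h2) _.
rewrite le_eqVlt; apply/orP; left; apply/eqP; field; exact: lt0r_neq0.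
Qed.

End MatrixContraction.

Section Contraction.
Variable R : realType.
Implicit Types (f : int * int -> R[i]) (th : R * R) (l : R) (mu : R[i]).
Local Notation Z2 := (int * int)%type.

Lemma floquet_entry_le l th p q : `|floquet l th p q| <= (1 + `|l|)%:C.
Proof.
rewrite /floquet; case/mxvec_indexP: p => i j; case/mxvec_indexP: q => k m.
rewrite symbolE; apply: le_trans (ler_normD _ _) _.
rewrite !normrM !hop_norm ?norm_cis// mulr1 rmorphD /= lerD2l.
have -> : `|l%:C| = (`|l|)%:C by rewrite normc_def /= expr0n addr0 sqrtr_sqr.
have S a b : `|sgnmx R[i] a b| <= 1.
  rewrite !mxE /site_sign; case: (a == b); rewrite ?mulr0n ?normr0// mulr1n.
  by case: ifP => _; rewrite ?normrN normr1.
rewrite -[leRHS]mulr1 ler_wpM2l ?ler0c//.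
by rewrite -[leRHS]mulr1 ler_pM.
Qed.

Lemma floquet_contraction l mu : (forall th, floquet l th - mu%:M \in unitmx) ->
  exists t q : R, [/\ 0 < t, 0 <= q, q < 1 & forall x y,
    0 <= x <= pi *+ 2 -> 0 <= y <= pi *+ 2 -> forall v,
    sqnorm (v - t%:C *: (v *m (floquet l (x, y) - mu%:M) *m (floquet l (x, y) - mu^*%:M)))
      <= (q ^+ 2)%:C * sqnorm v].
Proof.
move=> inv; have [e e0 lo] := floquet_lower_bound inv.
(* Capping [e] at 1 makes [1 - e' ^+ 2 / k] nonnegative, so that it is the square of its root
   [q]. *)
pose e' := Num.min e 1; have e'0 : 0 < e' by rewrite lt_min e0 ltr01.
pose c : R := 1 + `|l| + ComplexField.Normc.normc mu.
have m0 : 0 <= ComplexField.Normc.normc mu by case: (mu) => *; exact: sqrtr_ge0.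
have c1 : 1 <= c by rewrite /c -addrA lerDl addr_ge0.
(* Entries are bounded by [c], so each of the two 9 x 9 factors multiplies [sqnorm] by at most
   [(9 * c) ^+ 2]. *)
pose k : R := (9 * c) ^+ 4.
have k1 : 1 <= k by rewrite exprn_ege1//; lra.
have k0 : 0 < k by lra.
have e1 : e' <= 1 by rewrite ge_min lexx orbT.
have q0 : 0 <= 1 - e' ^+ 2 / k.
  by rewrite subr_ge0 ler_pdivrMr// mul1r (le_trans _ k1)// exprn_ile1// ltW.
exists (e' / k), (Num.sqrt (1 - e' ^+ 2 / k)); split.
- by rewrite divr_gt0.
- exact: sqrtr_ge0.
- rewrite -[ltRHS]sqrtr1 ltr_sqrt// ltrBlDr ltrDl divr_gt0// exprn_gt0//.
move=> x y hx hy v; rewrite sqr_sqrtr//; set F := floquet l (x, y).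
have NtE : (F - mu%:M) ^t* = F - mu^*%:M.
  by rewrite linearB /= map_mxB floquet_herm tr_scalar_mx map_scalar_mx.
have entry (nu : R[i]) : `|nu| = `|mu| -> forall i j, `|(F - nu%:M) i j| <= c%:C.
  move=> nm i j; have -> : (F - nu%:M) i j = F i j - (nu%:M : 'M[R[i]]_(3 * 3)) i j.
    by move: (F) => G; rewrite !mxE.
  apply: le_trans (ler_normB _ _) _; rewrite rmorphD /= lerD ?floquet_entry_le//.
  rewrite mxE -[(ComplexField.Normc.normc mu)%:C]/`|mu| -nm.
  by case: (i == j); rewrite ?mulr1n ?mulr0n ?normr0.
have bd (nu : R[i]) w : `|nu| = `|mu| ->
    sqnorm (w *m (F - nu%:M)) <= ((9 * c) ^+ 2)%:C * sqnorm w.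
  move=> nm; apply: le_trans (sqnorm_mul_small _ (entry nu nm)) _.
  by rewrite rmorphXn rmorphM /= rmorph_nat.
have -> : (1 - e' ^+ 2 / k)%:C = 1 - e'%:C ^+ 2 / k%:C.
  by rewrite rmorphB /= rmorphM /= rmorphXn /= fmorphV.
have -> : (e' / k)%:C = e'%:C / k%:C by rewrite rmorphM /= fmorphV.
rewrite -mulmxA -NtE.
apply: sqnorm_contraction.
- by rewrite -[0]/(0%:C) ltcR.
- by rewrite -[0]/(0%:C) ltcR.
- apply: le_trans (lo x y hx hy v); rewrite ler_wpM2r ?sqnorm_ge0// lecR.
  by rewrite ge_min lexx.
rewrite NtE mulmxA; apply: le_trans (bd _ _ _) _; first by rewrite norm_conjC.
have -> : k%:C = ((9 * c) ^+ 2)%:C * ((9 * c) ^+ 2)%:C.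
  by rewrite -rmorphM -exprD.
rewrite -mulrA ler_wpM2l ?bd//.
by rewrite -[0]/(0%:C) lecR exprn_even_ge0.
Qed.

End Contraction.

(** * Resolvent *)

Section BoxContraction.
Variable R : realType.
Implicit Types (f g : int * int -> R[i]) (th : R * R) (l : R) (mu : R[i]).
Local Notation Z2 := (int * int)%type.

Lemma mem_offsets_le1 (d : Z2) : d \in 0 :: ehm_offsets ->
  (`|d.1|%N <= 1)%N && (`|d.2|%N <= 1)%N.
Proof. by move: d; apply/allP. Qed.

Lemma mem_box_shift K (n d : Z2) : n \in box K -> d \in 0 :: ehm_offsets ->
  n + d \in box K.+1.
Proof.
move=> nK /mem_offsets_le1 d1; move: nK d1; rewrite !mem_box.
by case: n => a b; case: d => c e /=; lia.
Qed.

Lemma eq_schrodinger l mu K f g : (forall n, n \in box K.+1 -> f n = g n) ->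
  forall n, n \in box K -> schrodinger l mu f n = schrodinger l mu g n.
Proof.
move=> fg n nK; rewrite /schrodinger (fg n); last first.
  by rewrite -[n]addr0; apply: mem_box_shift => //; rewrite inE eqxx.
congr (_ + _ - _); apply: eq_big_seq => d dO; apply: fg; exact: mem_box_shift.
Qed.

Lemma supported_schrodinger l mu K f : supported K f -> supported K.+1 (schrodinger l mu f).
Proof.
move=> sf n nK; rewrite /schrodinger.
have out d : d \in 0 :: ehm_offsets -> f (n + d) = 0.
  move=> dO; apply: sf; apply: contra nK => nd.
  rewrite -[n](addrK d); move: nd (mem_offsets_le1 dO); rewrite !mem_box.
  by case: n => a b; case: (d) => c e /=; lia.
rewrite big1_seq => [|d /andP[_]]; last exact: out.
have -> : f n = 0 by rewrite -[n]addr0; apply: out; rewrite inE eqxx.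
by rewrite !mulr0 addr0 subr0.
Qed.

Lemma mxvec_transform_schrodinger l mu K L f th : supported K f -> (K + 1 <= L)%N ->
  mxvec (transform L (schrodinger l mu f) th) =
  mxvec (transform L f th) *m (floquet l th - mu%:M).
Proof.
move=> sf KL; rewrite (transform_schrodinger l mu th sf KL) mulmxBr mul_mx_scalar.
have fE X : mxvec X *m floquet l th = mxvec (symbol_op l%:C (cis th.1) (cis th.2) X).
  exact: mxvec_symbol.
by rewrite fE; move: (symbol_op _ _ _ _) => Y; rewrite linearB linearZ.
Qed.

(* A step of the gradient iteration for the normal equation of
   [schrodinger l mu]. *)
Definition relax l mu t f : Z2 -> R[i] :=
  f - t%:C *: schrodinger l mu^* (schrodinger l mu f).

(** Two applications of a nearest-neighbour operator enlarge the support by 2. On the box [K.+2]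
    Parseval's identity turns the contraction at each momentum into one for the sum over sites. *)
Lemma relax_box l mu t q K f :
  (forall x y, 0 <= x <= pi *+ 2 -> 0 <= y <= pi *+ 2 -> forall v,
    sqnorm (v - t%:C *: (v *m (floquet l (x, y) - mu%:M) *m (floquet l (x, y) - mu^*%:M)))
      <= (q ^+ 2)%:C * sqnorm v) ->
  supported K f ->
  \sum_(n <- box K.+2) `|relax l mu t f n| ^+ 2 <=
  (q ^+ 2)%:C * \sum_(n <- box K.+2) `|f n| ^+ 2.
Proof.
move=> con sf; pose L := K.+2; pose N := (2 * L).+1.
have LN : (2 * L < N)%N by rewrite /N.
have N0 : 0 < (N ^ 2)%:R :> R[i] by rewrite ltr0n expn_gt0.
rewrite -(ler_pM2l N0) mulrCA -!(parseval_transform _ LN) mulr_sumr.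
apply: ler_sum => a _; rewrite mulr_sumr; apply: ler_sum => b _.
set th := (_, _).
have -> : mxvec (transform L (relax l mu t f) th) = mxvec (transform L f th) -
  t%:C *: (mxvec (transform L f th) *m (floquet l th - mu%:M) *m (floquet l th - mu^*%:M)).
  rewrite /relax -scaleNr transformD transformZ linearD linearZ /= scaleNr.
  rewrite (@mxvec_transform_schrodinger l _ K.+1 L); last 2 first.
  - exact: supported_schrodinger.
  - by rewrite /L addn1.
  by rewrite (@mxvec_transform_schrodinger l _ K L)// /L; lia.
by apply: con; apply: grid_bounds.
Qed.

Lemma sum_normc2 (s : seq Z2) f :
  \sum_(n <- s) `|f n| ^+ 2 = (\sum_(n <- s) normc (f n) ^+ 2)%:C.
Proof. by rewrite rmorph_sum; apply: eq_bigr => n _; rewrite rmorphXn. Qed.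

Lemma finite_sub_box (X : set Z2) : finite_set X -> exists K, X `<=` [set` box K].
Proof.
move=> /finite_seqP[Y ->].
exists (\max_(n <- Y) maxn (absz n.1) (absz n.2)) => n /= nY.
rewrite mem_box -geq_max.
exact: (@leq_bigmax_seq _ Y xpredT (fun n => maxn (absz n.1) (absz n.2)) n nY isT).
Qed.

Lemma mass_ge_seq (s : seq Z2) f : uniq s ->
  ((\sum_(n <- s) normc (f n) ^+ 2)%:E <= ell2_mass f)%E.
Proof.
move=> us; rewrite -sumEFin; apply: esum_ge; exists [set` s].
  by split => //; exact: finite_seq.
by rewrite fsbig_seq.
Qed.

Lemma mass_relax l mu t q f :
  (forall x y, 0 <= x <= pi *+ 2 -> 0 <= y <= pi *+ 2 -> forall v,
    sqnorm (v - t%:C *: (v *m (floquet l (x, y) - mu%:M) *m (floquet l (x, y) - mu^*%:M)))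
      <= (q ^+ 2)%:C * sqnorm v) ->
  (ell2_mass (relax l mu t f) <= (q ^+ 2)%:E * ell2_mass f)%E.
Proof.
move=> con; rewrite ge_ereal_sup//= => _ [X [finX _] <-].
have [K XK] := finite_sub_box finX.
(* On [box K] the relaxed function sees [f] only on [box K.+2], so [f] may be truncated there; the
   relaxed truncation is then supported in [box K.+4]. *)
pose g n := if n \in box K.+2 then f n else 0.
have sg : supported K.+2 g by move=> n /negbTE nK; rewrite /g nK.
have relE n : n \in box K -> relax l mu t f n = relax l mu t g n.
  move=> nK; rewrite /relax.
  rewrite -[LHS]/(f n - t%:C * schrodinger l mu^* (schrodinger l mu f) n).
  rewrite -[RHS]/(g n - t%:C * schrodinger l mu^* (schrodinger l mu g) n).
  have fg m : m \in box K.+2 -> f m = g m by rewrite /g => ->.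
  rewrite -fg; last by move: nK; rewrite !mem_box; lia.
  congr (_ - _ * _); apply: (@eq_schrodinger _ _ K) => // m mK.
  exact: (@eq_schrodinger _ _ K.+1).
apply: (@le_trans _ _ (\sum_(n <- box K.+4) normc (relax l mu t g n) ^+ 2)%:E).
  rewrite -sumEFin [leRHS]fsbig_seq ?box_uniq//.
  rewrite (eq_fsbigr (fun n => (normc (relax l mu t g n) ^+ 2)%:E)); last first.
    by move=> n; rewrite inE => Xn; rewrite (relE n (XK n Xn)).
  apply: lee_fsum_nneg_subset => //.
  - move=> n; rewrite !inE => Xn; have := XK n Xn; rewrite /= !mem_box; lia.
  - by move=> n _; rewrite lee_fin sqr_ge0.
have := relax_box con sg; rewrite !sum_normc2 -rmorphM lecR => h.
apply: (@le_trans _ _ (q ^+ 2 * \sum_(n <- box K.+4) normc (g n) ^+ 2)%:E).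
  by rewrite lee_fin.
rewrite EFinM lee_wpmul2l ?lee_fin ?sqr_ge0//.
apply: le_trans (mass_ge_seq f (box_uniq K.+4)); rewrite lee_fin.
apply: ler_sum => n _; rewrite /g; case: ifP => // _.
by rewrite normc0 expr0n sqr_ge0.
Qed.

End BoxContraction.

Section Ell2Norm.
Variables (R : realType) (I : choiceType).
Local Notation H := (ell2 R I).
Implicit Types (x y : H) (c : R[i]).

Lemma ell2_funD x y n : (x + y) n = x n + y n. Proof. by []. Qed.
Lemma ell2_funB x y n : (x - y) n = x n - y n. Proof. by []. Qed.
Lemma ell2_funZ c x n : (c *: x) n = c * x n. Proof. by []. Qed.
Lemma ell2_fun_sum (J : Type) (s : seq J) (F : J -> H) n :
  (\sum_(j <- s) F j) n = \sum_(j <- s) F j n.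
Proof. by elim/big_ind2 : _ => // _ a _ b <- <-. Qed.

Lemma ell2P x y : (forall n, x n = y n) -> x = y.
Proof. by move=> xy; apply/val_inj/funext. Qed.

Definition rnorm x : R := Num.sqrt (fine (ell2_mass x)).

Lemma rnormE x : `|x| = (rnorm x)%:C. Proof. by []. Qed.

Lemma rnorm_ge0 x : 0 <= rnorm x. Proof. exact: sqrtr_ge0. Qed.

Lemma mass_rnorm x : ell2_mass x = (rnorm x ^+ 2)%:E.
Proof.
rewrite /rnorm sqr_sqrtr ?fine_ge0 ?ell2_mass_ge0// fineK//.
by apply: ell2_mass_fin; exact: ell2_funP.
Qed.

Lemma rnormD x y : rnorm (x + y) <= rnorm x + rnorm y.
Proof. by have := ler_normD x y; rewrite !rnormE -rmorphD lecR. Qed.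

Lemma rnormZ c x : rnorm (c *: x) = normc c * rnorm x.
Proof.
have := normrZ c x; rewrite !rnormE -[`|c|]/((normc c)%:C) -rmorphM.
exact: complexI.
Qed.

Lemma normc_ge0 c : 0 <= normc c. Proof. by case: c => *; exact: sqrtr_ge0. Qed.

Lemma normc_real (a : R) : normc a%:C = `|a|.
Proof. by rewrite /normc /= expr0n/= addr0 sqrtr_sqr. Qed.

Lemma rnorm_le x y (M : R) : 0 <= M ->
  (ell2_mass y <= (M ^+ 2)%:E * ell2_mass x)%E -> rnorm y <= M * rnorm x.
Proof.
move=> M0; rewrite !mass_rnorm -EFinM lee_fin -exprMn.
by rewrite ler_pXn2r// ?nnegrE ?mulr_ge0 ?rnorm_ge0.
Qed.

Lemma normc_le_rnorm x n : normc (x n) <= rnorm x.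
Proof.
have := ell2_mass_term x n; rewrite mass_rnorm lee_fin.
by rewrite ler_pXn2r// nnegrE ?rnorm_ge0 ?normc_ge0.
Qed.

End Ell2Norm.

(** * The operator on square summable functions *)

Section GapOperator.
Variables (R : realType) (l : R).
Local Notation Z2 := (int * int)%type.
Local Notation H := (ell2 R Z2).
Implicit Types (psi : H) (E mu : R[i]).

Definition gap_op psi : H := (ehm_laplacian psi + l%:C *: potential (@gap_potential R) psi)%R.

Lemma gap_potential_norm n : `|gap_potential R n| = 1.
Proof.
have S m : `|line_sign R m| = 1.
  by rewrite /line_sign; case: ifP => _; rewrite ?normrN normr1.
by rewrite normrM !S mulr1.
Qed.

Lemma gap_potential_bounded : exists M, forall n, `|gap_potential R n| <= M.
Proof. by exists 1 => n; rewrite gap_potential_norm. Qed.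

Lemma gap_op_fun E psi : ell2_fun (gap_op psi - E *: psi) = schrodinger l (E + 1) psi.
Proof.
apply/funext => n.
rewrite ell2_funB ell2_funD !ell2_funZ potentialE; last exact: gap_potential_bounded.
rewrite -[ehm_laplacian psi n]/(ehm_adjacency psi n) ehm_adjacencyE.
rewrite /schrodinger [in RHS]big_cons addr0 [(l * _)%:C]rmorphM /=.
by move: (gap_potential R n)%:C => v; ring.
Qed.

Lemma shift_ell2 psi (d : Z2) : (fun n => psi (n + d)) \in @square_summable R _.
Proof. exact/square_summable_shift/ell2_funP. Qed.

Lemma rnorm_shift psi d : rnorm (Ell2 (shift_ell2 psi d)) = rnorm psi.
Proof.
rewrite /rnorm; congr (Num.sqrt (fine _)).
rewrite /ell2_mass /= -(@reindex_esum _ _ _ setT setT (fun n => n + d)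
  (fun n => (normc (psi n) ^+ 2)%:E))//.
split => [x _ //|x y _ _ /addIr//|x _].
by exists (x - d) => //; rewrite subrK.
Qed.

Lemma rnorm_sum (J : Type) (s : seq J) (F : J -> H) :
  rnorm (\sum_(j <- s) F j) <= \sum_(j <- s) rnorm (F j).
Proof.
elim/big_ind2 : _ => //; first by rewrite -lecR -rnormE normr0.
by move=> x a y b xa yb; apply: le_trans (rnormD _ _) _; rewrite lerD.
Qed.

Lemma rnorm_laplacian psi : rnorm (ehm_laplacian psi) <= 8 * rnorm psi.
Proof.
have -> : ehm_laplacian psi = \sum_(d <- ehm_offsets) Ell2 (shift_ell2 psi d).
  apply: ell2P => n; rewrite ell2_fun_sum.
  by rewrite -[LHS]/(ehm_adjacency psi n) ehm_adjacencyE.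
apply: le_trans (rnorm_sum _ _) _.
rewrite (eq_bigr (fun=> rnorm psi)) => [|d _]; last exact: rnorm_shift.
by rewrite big_const_seq /= addr0 mulr_natl !mulrS addr0.
Qed.

Lemma rnorm_gap_op E psi :
  rnorm (gap_op psi - E *: psi) <= (8 + `|l| + normc E) * rnorm psi.
Proof.
have -> : (8 + `|l| + normc E) * rnorm psi =
  8 * rnorm psi + `|l| * rnorm psi + normc E * rnorm psi by ring.
rewrite -scaleNr; apply: le_trans (rnormD _ _) _; apply: lerD; last first.
  by rewrite rnormZ normcN.
rewrite /gap_op; apply: le_trans (rnormD _ _) _.
apply: lerD; first exact: rnorm_laplacian.
rewrite rnormZ normc_real ler_wpM2l// -[leRHS]mul1r; apply: rnorm_le => //.
apply: ell2_mass_le => n; rewrite potentialE; last exact: gap_potential_bounded.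
by rewrite normcM normc_real gap_potential_norm.
Qed.

Lemma schrodinger_linear mu (c : R[i]) (f g : Z2 -> R[i]) :
  schrodinger l mu (c *: f + g) = c *: schrodinger l mu f + schrodinger l mu g.
Proof.
apply/funext => n; rewrite -[RHS]/(c * schrodinger l mu f n + schrodinger l mu g n).
rewrite /schrodinger; under eq_bigr do rewrite -[(c *: f + g) _]/(c * f _ + g _).
rewrite big_split /= -mulr_sumr -[(c *: f + g) n]/(c * f n + g n).
by move: (\sum_(d <- _) f _) (\sum_(d <- _) g _) (_%:C) => a b d; ring.
Qed.

Lemma schrodingerB mu (f g : Z2 -> R[i]) :
  schrodinger l mu (f - g) = schrodinger l mu f - schrodinger l mu g.
Proof. by rewrite addrC -scaleN1r schrodinger_linear scaleN1r addrC. Qed.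

Lemma schrodingerZ mu c (f : Z2 -> R[i]) :
  schrodinger l mu (c *: f) = c *: schrodinger l mu f.
Proof. by rewrite -[c *: f](addrK f) schrodingerB schrodinger_linear !addrK. Qed.

Lemma schrodinger0E mu (f : Z2 -> R[i]) :
  schrodinger l mu f = schrodinger l 0 f - mu *: f.
Proof.
apply/funext => n; rewrite -[RHS]/(schrodinger l 0 f n - mu * f n).
by rewrite /schrodinger mul0r subr0.
Qed.

(** Both operators are [schrodinger l 0] minus a scalar. *)
Lemma schrodinger_commute mu nu (f : Z2 -> R[i]) :
  schrodinger l mu (schrodinger l nu f) = schrodinger l nu (schrodinger l mu f).
Proof.
rewrite (schrodinger0E mu (schrodinger l nu f)) (schrodinger0E nu (schrodinger l mu f)).
rewrite (schrodinger0E mu f) (schrodinger0E nu f).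
rewrite (schrodingerB 0 (schrodinger l 0 f) (nu *: f)) (schrodingerZ 0 nu f).
rewrite (schrodingerB 0 (schrodinger l 0 f) (mu *: f)) (schrodingerZ 0 mu f).
move: (schrodinger l 0 f) => b; move: (schrodinger l 0 b) => a.
apply/funext => n.
change (a n - nu * b n - mu * (b n - nu * f n) = a n - mu * b n - nu * (b n - mu * f n)).
ring.
Qed.

Lemma gap_op_linear E c x y : gap_op (c *: x + y) - E *: (c *: x + y) =
  c *: (gap_op x - E *: x) + (gap_op y - E *: y).
Proof.
apply: ell2P => n; rewrite [LHS](congr1 (fun f => f n) (gap_op_fun E (c *: x + y))).
rewrite -[ell2_fun (c *: x + y)]/(c *: ell2_fun x + ell2_fun y) schrodinger_linear.
by rewrite -!gap_op_fun.
Qed.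

End GapOperator.

Section Geometric.
Variable R : realType.

(** The intervals of radius [D * q ^+ k] around [u k] are nested, and the supremum of their left
    ends lies in all of them. *)
Lemma geometric_limit (u : nat -> R) (c q : R) : 0 <= c -> 0 <= q -> q < 1 ->
  (forall k, `|u k.+1 - u k| <= c * q ^+ k) ->
  exists z, forall k, `|u k - z| <= c / (1 - q) * q ^+ k.
Proof.
move=> c0 q0 q1 uq; set D := c / (1 - q).
have D0 : 0 <= D by rewrite divr_ge0// subr_ge0 ltW.
have DE : D * (1 - q) = c by rewrite mulfVK// subr_eq0 gt_eqF.
have step k : u k - D * q ^+ k <= u k.+1 - D * q ^+ k.+1 /\
    u k.+1 + D * q ^+ k.+1 <= u k + D * q ^+ k.
  have := uq k; rewrite ler_norml -DE exprS => /andP[].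
  by move: (q ^+ k) => x *; split; lra.
have lo j k : (j <= k)%N -> u j - D * q ^+ j <= u k - D * q ^+ k.
  move=> /subnKC <-; elim: (k - j)%N => [|m IH]; first by rewrite addn0.
  by apply: le_trans IH _; rewrite addnS; case: (step (j + m)%N).
have hi j k : (j <= k)%N -> u k + D * q ^+ k <= u j + D * q ^+ j.
  move=> /subnKC <-; elim: (k - j)%N => [|m IH]; first by rewrite addn0.
  by apply: le_trans IH; rewrite addnS; case: (step (j + m)%N).
have lohi j k : u j - D * q ^+ j <= u k + D * q ^+ k.
  have h := lo j (maxn j k) (leq_maxl _ _); have h' := hi k (maxn j k) (leq_maxr _ _).
  apply: le_trans h _; apply: le_trans h'.
  have : 0 <= D * q ^+ maxn j k by rewrite mulr_ge0// exprn_ge0.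
  lra.
pose A := [set u j - D * q ^+ j | j in setT].
have A0 : A !=set0 by exists (u 0 - D * q ^+ 0), 0.
have ubA k : ubound A (u k + D * q ^+ k) by move=> _ [j _ <-].
exists (sup A) => k; rewrite ler_norml.
have h1 : u k - D * q ^+ k <= sup A.
  by apply: ub_le_sup; [exists (u 0 + D * q ^+ 0); exact: ubA|exists k].
have h2 : sup A <= u k + D * q ^+ k by apply: ge_sup.
by apply/andP; split; lra.
Qed.

Lemma geometric_limitC (u : nat -> R[i]) (c q : R) : 0 <= c -> 0 <= q -> q < 1 ->
  (forall k, normc (u k.+1 - u k) <= c * q ^+ k) ->
  exists z, forall k, normc (u k - z) <= 2 * c / (1 - q) * q ^+ k.
Proof.
move=> c0 q0 q1 uq.
have re (a b : R) : `|a| <= normc (a +i* b).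
  by rewrite -sqrtr_sqr ler_sqrt ?addr_ge0 ?sqr_ge0// lerDl sqr_ge0.
have im (a b : R) : `|b| <= normc (a +i* b).
  by rewrite -sqrtr_sqr ler_sqrt ?addr_ge0 ?sqr_ge0// lerDr sqr_ge0.
have [|a ha] := @geometric_limit (fun k => complex.Re (u k)) c q c0 q0 q1.
  move=> k; apply: le_trans (uq k).
  by case: (u k.+1) => a b; case: (u k) => d e /=; exact: re.
have [|b hb] := @geometric_limit (fun k => complex.Im (u k)) c q c0 q0 q1.
  move=> k; apply: le_trans (uq k).
  by case: (u k.+1) => ? ?; case: (u k) => d e /=; exact: im.
exists (a +i* b) => k; have := ha k; have := hb k.
case: (u k) => d e /= h1 h2.
have := norm_complex_le (d - a) (e - b); rewrite -[`|_ +i* _|]/((normc _)%:C) lecR => h.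
apply: le_trans h _; lra.
Qed.

Lemma geometric_le0 (a D q : R) : 0 <= q -> q < 1 ->
  (forall k, a <= D * q ^+ k) -> a <= 0.
Proof.
move=> q0 q1 aD; have c0 : D * q ^+ k @[k --> \oo] --> D * 0.
  by apply: cvgMl_tmp; apply: cvg_expr; rewrite ger0_norm.
rewrite mulr0 in c0; rewrite -(cvg_lim _ c0)//.
by apply: limr_ge; [exact: cvgP c0|exact: nearW].
Qed.

End Geometric.

Lemma resolvent_setI (K : numFieldType) (E : normedModType K) (A : E -> E) (z : K)
    (C : K) :
  C \is Num.real ->
  (forall c x y, A (c *: x + y) - z *: (c *: x + y) = c *: (A x - z *: x) + (A y - z *: y)) ->
  (forall y, exists x, A x - z *: x = y) ->
  (forall x, `|x| <= C * `|A x - z *: x|) ->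
  resolvent_set A z.
Proof.
move=> Cr linA surjA lowA; pose T x := A x - z *: x.
have injT x y : T x = T y -> x = y.
  move=> Txy; apply/eqP; rewrite -subr_eq0 -normr_le0.
  have -> : x - y = (-1) *: y + x by rewrite scaleN1r addrC.
  apply: le_trans (lowA _) _; rewrite linA -!/(T _) Txy scaleN1r addNr normr0 mulr0//.
have [B TB] := choice surjA.
have linB : linear B.
  by move=> c x y; apply: injT; rewrite /T linA !TB.
pose Bl : {linear E -> E} := HB.pack B (GRing.isLinear.Build _ _ _ _ B linB).
exists Bl; split.
- apply: bounded_linear_continuous; apply/linear_boundedP.
  exists C; split => // r Cr' x; apply: le_trans (lowA _) _.
  by rewrite [A _ - _]TB ler_wpM2r// ltW.
- by move=> x; apply: injT; rewrite /T [LHS]TB.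
- by move=> x; rewrite [LHS]TB.
Qed.

Section Neumann.
Variables (R : realType) (l : R) (E : R[i]).
Local Notation Z2 := (int * int)%type.
Local Notation H := (ell2 R Z2).
Local Notation mu := (E + 1).
Implicit Types (psi : H).

Local Notation T := (fun psi : H => gap_op l psi - E *: psi).
Local Notation T' := (fun psi : H => gap_op l psi - E^* *: psi).

Lemma conjD1 : (E + 1)^* = E^* + 1.
Proof. by rewrite rmorphD rmorph1. Qed.

Definition step (t : R) psi : H := psi - t%:C *: T' (T psi).

Lemma step_fun t psi : ell2_fun (step t psi) = relax l mu t psi.
Proof.
rewrite /relax -gap_op_fun conjD1 -gap_op_fun.
by apply/funext.
Qed.

Lemma stepD t x y : step t (x + y) = step t x + step t y.
Proof.
have L F x' y' : gap_op l (x' + y') - F *: (x' + y') =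
    (gap_op l x' - F *: x') + (gap_op l y' - F *: y').
  by have := gap_op_linear l F 1 x' y'; rewrite !scale1r.
by rewrite /step (L E x y) (L E^* (T x) (T y)) scalerDr opprD addrACA.
Qed.

Lemma step0 t : step t 0 = 0.
Proof. by apply: (addIr (step t 0)); rewrite -stepD !add0r. Qed.

(** The sup norm is used because the partial sums of the Neumann series are compared with their
    limit site by site. *)
Lemma schrodinger_sup nu (f : Z2 -> R[i]) (M : R) : (forall n, normc (f n) <= M) ->
  forall n, normc (schrodinger l nu f n) <= (9 + `|l| + normc nu) * M.
Proof.
move=> fM n.
have cn (c : R[i]) : `|c| = (normc c)%:C by [].
rewrite -lecR -cn; apply: le_trans (ler_normB _ _) _.
rewrite mulrDl rmorphD lerD//; last first.
  by rewrite normrM rmorphM ler_wpM2l// cn lecR.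
apply: le_trans (ler_normD _ _) _; rewrite mulrDl rmorphD lerD//; last first.
  rewrite normrM !cn normc_real normrM gap_potential_norm mulr1 -rmorphM lecR.
  by rewrite ler_wpM2l.
apply: le_trans (ler_norm_sum _ _ _) _.
apply: le_trans (_ : \sum_(d <- 0 :: ehm_offsets) M%:C <= _).
  by apply: ler_sum => d _; rewrite cn lecR.
by rewrite big_const_seq /= addr0 -[leRHS]/((9 * M)%:C) mulr_natl -!rmorphD lecR !mulrS mulr0n addr0.
Qed.

Variables (t q : R).
Hypotheses (t0 : 0 < t) (q0 : 0 <= q) (q1 : q < 1).
Hypothesis contr : forall psi, rnorm (step t psi) <= q * rnorm psi.

(* The Neumann series converges at every site, with rate [q ^ k], so the limit
   can be taken pointwise. *)
Lemma step_solve (b : H) : exists x : H, step t x = x - b.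
Proof.
pose w k := iter k (step t) b; pose x k := \sum_(j < k) w j.
have xS k : x k.+1 = x k + w k by rewrite /x big_ord_recr.
have wk k : rnorm (w k) <= rnorm b * q ^+ k.
  elim: k => [|k IH]; first by rewrite mulr1.
  apply: le_trans (contr _) _; rewrite exprS mulrCA ler_wpM2l//.
have stepx k : step t (x k) = x k + w k - b.
  elim: k => [|k IH]; first by rewrite /x big_ord0 step0 add0r subrr.
  by rewrite xS stepD IH addrAC.
pose G := rnorm b / (1 - q).
have q1' : 0 < 1 - q by rewrite subr_gt0.
have GE : rnorm b = G * (1 - q) by rewrite mulfVK// gt_eqF.
have G0 : 0 <= G by rewrite divr_ge0 ?rnorm_ge0// ltW.
have xk k : rnorm (x k) <= G.
  elim: k => [|k IH].
    by rewrite /x big_ord0 -lecR -rnormE normr0 ler0c.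
  have -> : x k.+1 = step t (x k) + b by rewrite stepx subrK xS.
  apply: le_trans (rnormD _ _) _.
  have := contr (x k); have := ler_wpM2l q0 IH; rewrite GE; lra.
pose D := 2 * rnorm b / (1 - q).
have D0 : 0 <= D by rewrite divr_ge0 ?mulr_ge0 ?rnorm_ge0// ltW.
have lim n : exists zn, forall k, normc (x k n - zn) <= D * q ^+ k.
  apply: geometric_limitC => //; first exact: rnorm_ge0.
  move=> k; rewrite xS ell2_funD [x k n + _]addrC addrK.
  exact: le_trans (normc_le_rnorm _ _) (wk k).
have [z hz] := choice lim.
have q20 : 0 <= q ^+ 2 by rewrite exprn_ge0.
have q21 : q ^+ 2 < 1 by rewrite expr_lt1.
(* A Fatou argument: on a fixed box |z|^2 <= 2 |x k|^2 + 2 |x k - z|^2, the first sum is at most 2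
   G^2, and the second tends to 0 with [k]. *)
have zl2 : z \in @square_summable R _.
  apply/square_summableP; apply: (@le_lt_trans _ _ (2 * G ^+ 2)%:E); last exact: ltry.
  rewrite ge_ereal_sup//= => _ [X [finX _] <-].
  have [K XK] := finite_sub_box finX.
  apply: (@le_trans _ _ (\sum_(n <- box K) normc (z n) ^+ 2)%:E).
    rewrite -sumEFin [leRHS]fsbig_seq ?box_uniq//.
    apply: lee_fsum_nneg_subset => //.
    - by move=> n; rewrite !inE => Xn; have := XK n Xn.
    - by move=> n _; rewrite lee_fin sqr_ge0.
  rewrite lee_fin -subr_le0.
  apply: (@geometric_le0 _ _ (\sum_(n <- box K) 2 * D ^+ 2) (q ^+ 2)) => // k.
  rewrite lerBlDr -exprM mulnC exprM mulr_suml.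
  have h : \sum_(n <- box K) normc (x k n) ^+ 2 <= G ^+ 2.
    rewrite -lee_fin; apply: le_trans (mass_ge_seq _ (box_uniq K)) _.
    by rewrite mass_rnorm lee_fin ler_pXn2r// nnegrE rnorm_ge0.
  apply: le_trans (_ : \sum_(n <- box K) (2 * D ^+ 2 * (q ^+ k) ^+ 2 + 2 * normc (x k n) ^+ 2) <= _).
    apply: ler_sum => n _; have := hz n k; set d := normc _ => hd.
    have zn : normc (z n) <= normc (x k n) + d.
      have -> : z n = x k n + - (x k n - z n) by rewrite opprB addrC subrK.
      by apply: le_trans (le_normcD _ _) _; rewrite normcN.
    have d0 : 0 <= d by exact: normc_ge0.
    have a0 : 0 <= normc (x k n) by exact: normc_ge0.
    have z0 : 0 <= normc (z n) by exact: normc_ge0.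
    have h1 : normc (z n) ^+ 2 <= (normc (x k n) + d) ^+ 2.
      by rewrite ler_pXn2r ?nnegrE ?addr_ge0.
    have h2 : d ^+ 2 <= D ^+ 2 * (q ^+ k) ^+ 2.
      have Dq : 0 <= D * q ^+ k := mulr_ge0 D0 (exprn_ge0 k q0).
      by rewrite -exprMn ler_pXn2r // nnegrE.
    have h3 : 0 <= (normc (x k n) - d) ^+ 2 by exact: sqr_ge0.
    by move: h1 h2 h3; rewrite sqrrB sqrrD; lra.
  by rewrite big_split /= lerD2l -mulr_sumr ler_wpM2l.
exists (Ell2 zl2); apply: ell2P => n.
pose c := normc (step t (Ell2 zl2) n - (Ell2 zl2 - b) n).
suff : c = 0 by move=> /eq0_normc /eqP; rewrite subr_eq0 => /eqP.
apply/eqP; rewrite eq_le normc_ge0 andbT.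
pose B := (9 + `|l| + normc mu^*) * (9 + `|l| + normc mu).
apply: (@geometric_le0 _ _ (t * (B * D) + rnorm b) q) => // k.
(* Subtracting the exact relation [stepx] for [x k] leaves the operator applied to [z - x k] and the
   tail term [w k], both of order [q ^+ k]. *)
rewrite /c; have -> : step t (Ell2 zl2) n - (Ell2 zl2 - b) n =
    - t%:C * schrodinger l mu^* (schrodinger l mu (z - x k)) n + w k n.
  have -> : w k n = step t (x k) n - (x k - b) n.
    by rewrite stepx ell2_funB ell2_funD ell2_funB; ring.
  rewrite !step_fun.
  rewrite (schrodingerB l mu) (schrodingerB l mu^*).
  rewrite -[relax l mu t z n]/(z n - t%:C * schrodinger l mu^* (schrodinger l mu z) n).
  rewrite -[relax l mu t (x k) n]/(x k n - t%:C * schrodinger l mu^* (schrodinger l mu (x k)) n).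
  rewrite !ell2_funB -[(_ - schrodinger l _ _) n]/(schrodinger l mu^* (schrodinger l mu z) n -
    schrodinger l mu^* (schrodinger l mu (x k)) n).
  rewrite -[Ell2 zl2 n]/(z n).
  move: (schrodinger l mu^* (schrodinger l mu z) n) => a.
  by move: (schrodinger l mu^* (schrodinger l mu (x k)) n) => a'; ring.
apply: le_trans (le_normcD _ _) _; rewrite mulrDl lerD//; last first.
  exact: le_trans (normc_le_rnorm _ _) (wk k).
rewrite normcM normcN normc_real gtr0_norm// /B -!mulrA ler_wpM2l ?(ltW t0)//.
apply: schrodinger_sup => m; apply: schrodinger_sup => m'.
have -> : (z - x k) m' = - (x k m' - z m') by rewrite opprB.
by rewrite normcN; have := hz m' k; rewrite /D -!mulrA.
Qed.

End Neumann.

Section Resolvent.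
Variables (R : realType) (l : R).
Local Notation Z2 := (int * int)%type.
Local Notation H := (ell2 R Z2).

Lemma gap_op_commute E F (x : H) :
  gap_op l (gap_op l x - E *: x) - F *: (gap_op l x - E *: x) =
  gap_op l (gap_op l x - F *: x) - E *: (gap_op l x - F *: x).
Proof.
apply: ell2P => n.
rewrite [LHS](congr1 (fun f => f n) (gap_op_fun l F _)) gap_op_fun.
rewrite [RHS](congr1 (fun f => f n) (gap_op_fun l E _)) gap_op_fun.
by rewrite schrodinger_commute.
Qed.

(** A fixed point of the relaxation with source solves T' T x = y, for T the operator minus [E] and
    T' the one minus its conjugate. As they commute, T' x is a preimage of y under T. The
    contraction also gives (1 - q) |x| <= t |T' T x|, hence the lower bound on T. *)
Lemma gap_op_resolvent E :
  (forall th, floquet l th - (E + 1)%:M \in unitmx) ->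
  resolvent_set (gap_op l : H -> H) E.
Proof.
move=> inv; have [t [q [t0 q0 q1 con]]] := floquet_contraction inv.
have contr (psi : H) : rnorm (step l E t psi) <= q * rnorm psi.
  by apply: rnorm_le => //; rewrite step_fun; exact: mass_relax con.
have tn0 : t%:C != 0 :> R[i] by rewrite -[0]/(0%:C) (inj_eq (@complexI R)) gt_eqF.
pose B := 8 + `|l| + normc E^*; have B0 : 0 <= B by rewrite !addr_ge0// normc_ge0.
have q1' : 0 < 1 - q by rewrite subr_gt0.
apply: (@resolvent_setI _ _ _ _ (t * B / (1 - q))%:C).
- by apply/complex_realP; exists (t * B / (1 - q)).
- by move=> c x y; exact: gap_op_linear.
- move=> y; have [x xE] := step_solve t0 q0 q1 contr (t%:C *: y).
  exists (gap_op l x - E^* *: x); rewrite gap_op_commute.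
  move: xE; rewrite /step => /addrI /oppr_inj /(scalerI tn0).
  exact.
move=> x; rewrite !rnormE -rmorphM lecR.
rewrite mulrAC ler_pdivlMr//.
pose y := gap_op l x - E *: x.
have xE : x = step l E t x + t%:C *: (gap_op l y - E^* *: y) by rewrite subrK.
have h1 : rnorm x <= rnorm (step l E t x) + rnorm (t%:C *: (gap_op l y - E^* *: y)).
  by rewrite {1}xE rnormD.
rewrite rnormZ normc_real gtr0_norm// in h1.
have h2 := ler_wpM2l (ltW t0) (rnorm_gap_op l E^* y).
have h3 := contr x; rewrite -/y -mulrA.
move: h1 h2 h3; rewrite -/B; move: (rnorm x) (rnorm (step _ _ _ _)) => a b.
move: (t * rnorm _) (t * (B * rnorm y)) => d e *; lra.
Qed.

End Resolvent.

(** * Weyl sequences *)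

Section Weights.
Variable R : realType.
Local Notation Z2 := (int * int)%type.

Definition dist1 (n : Z2) : nat := (absz n.1 + absz n.2)%N.

Lemma pow_ratio (r : R) a b : 0 < r -> r <= 1 -> (a <= b + 2)%N -> (b <= a + 2)%N ->
  `|r ^+ a - r ^+ b| <= (r ^- 2 - 1) * r ^+ a.
Proof.
move=> r0 r1 ab ba; have r0' := ltW r0.
have h1 : r ^+ 2 * r ^+ b <= r ^+ a by rewrite -exprD ler_wiXn2l// addnC.
have h2 : r ^+ 2 * r ^+ a <= r ^+ b by rewrite -exprD ler_wiXn2l// addnC.
have p2 : 0 < r ^+ 2 by rewrite exprn_gt0.
have r21 : r ^+ 2 <= 1 by rewrite exprn_ile1.
have a0 : 0 <= r ^+ a by rewrite exprn_ge0.
move: (r ^+ 2) (r ^+ a) (r ^+ b) h1 h2 p2 r21 a0 => s x y h1 h2 p2 r21 a0.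
have i1 : 1 <= s^-1 by rewrite invf_ge1.
have h3 : y <= s^-1 * x by rewrite ler_pdivlMl.
have h4 : (1 - s) * x <= (s^-1 - 1) * x.
  rewrite ler_wpM2r//.
  have -> : s^-1 - 1 = s^-1 * (1 - s) by rewrite mulrBr mulr1 mulVf// gt_eqF.
  by rewrite ler_peMl// subr_ge0.
rewrite ler_norml; apply/andP; split; last by move: h4; rewrite !mulrBl; lra.
by rewrite mulrBl; lra.
Qed.

Lemma sum_geometric_le (s : R) m : 0 <= s -> s < 1 ->
  \sum_(0 <= i < m) s ^+ i <= (1 - s)^-1.
Proof.
move=> s0 s1; have s1' : 0 < 1 - s by rewrite subr_gt0.
rewrite -[leRHS]mul1r ler_pdivlMr// big_mkord mulrC -opprB mulNr -subrX1 opprB.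
by rewrite gerBl exprn_ge0.
Qed.

Lemma sum_zbox_le (s : R) K : 0 <= s -> s < 1 ->
  \sum_(a <- zbox K) s ^+ (absz a) <= 2 / (1 - s).
Proof.
move=> s0 s1.
have -> : \sum_(a <- zbox K) s ^+ absz a =
  \sum_(a <- [seq Posz i | i <- iota 0 K.+1] ++ [seq Negz i | i <- iota 0 K]) s ^+ absz a.
  apply: perm_big; apply: uniq_perm; first exact: zbox_uniq.
    rewrite cat_uniq !map_inj_uniq ?iota_uniq/= ?andbT; last 2 first.
    - by move=> x y [].
    - by move=> x y [].
    by apply/hasPn => _ /mapP[x _ ->]; apply/negP => /mapP[y _].
  move=> a; rewrite mem_zbox mem_cat; apply/idP/orP => [aK|].
    case: a aK => x xK; [left|right]; apply/mapP; exists x => //; rewrite mem_iota; lia.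
  by case=> /mapP[x]; rewrite mem_iota => xK ->; lia.
rewrite big_cat !big_map /= mulr2n mulrDl mul1r lerD//.
  by have := sum_geometric_le K.+1 s0 s1; rewrite /index_iota subn0.
have := sum_geometric_le K s0 s1; rewrite /index_iota subn0; apply: le_trans.
by apply: ler_sum => i _; rewrite ler_wiXn2l// ltW.
Qed.

Lemma weight_ell2 (r M : R) (u : Z2 -> R[i]) : 0 < r -> r < 1 ->
  (forall n, normc (u n) <= M) ->
  (fun n => (r ^+ dist1 n)%:C * u n) \in @square_summable R _.
Proof.
move=> r0 r1 uM; have r0' := ltW r0.
have s0 : 0 <= r ^+ 2 by rewrite exprn_ge0.
have s1 : r ^+ 2 < 1 by rewrite expr_lt1.
have M0 : 0 <= M by apply: le_trans (uM 0); exact: normc_ge0.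
apply/square_summableP.
apply: (@le_lt_trans _ _ (M ^+ 2 * (2 / (1 - r ^+ 2)) ^+ 2)%:E); last exact: ltry.
rewrite ge_ereal_sup//= => _ [X [finX _] <-].
have [K XK] := finite_sub_box finX.
apply: (@le_trans _ _ (\sum_(n <- box K) M ^+ 2 * ((r ^+ 2) ^+ absz n.1 * (r ^+ 2) ^+ absz n.2))%:E).
  rewrite -sumEFin [leRHS]fsbig_seq ?box_uniq//.
  apply: (@le_trans _ _ (\sum_(n \in [set` box K]) (normc ((r ^+ dist1 n)%:C * u n) ^+ 2)%:E)%E).
    apply: lee_fsum_nneg_subset => //; first exact: finite_seq.
    - by move=> n; rewrite !inE => Xn; have := XK n Xn.
    - by move=> n _; rewrite lee_fin sqr_ge0.
  apply: lee_fsum; first exact: finite_seq.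
  move=> n _; rewrite lee_fin normcM normc_real ger0_norm ?exprn_ge0//.
  rewrite exprMn mulrC; apply: ler_pM; rewrite ?sqr_ge0//.
    by rewrite ler_pXn2r// nnegrE normc_ge0.
  by rewrite -exprD -exprM mulnC exprM.
rewrite lee_fin -mulr_sumr ler_wpM2l ?sqr_ge0// /box big_allpairs /=.
under eq_bigr do rewrite -mulr_sumr.
rewrite -mulr_suml expr2.
have z0 : 0 <= \sum_(a <- zbox K) (r ^+ 2) ^+ absz a.
  by apply: sumr_ge0 => a _; rewrite exprn_ge0.
by apply: ler_pM => //; exact: sum_zbox_le.
Qed.

End Weights.

Section Weyl.
Variables (R : realType) (l : R).
Local Notation Z2 := (int * int)%type.
Local Notation H := (ell2 R Z2).

(** The phase is the inverse of the one in [transform]: this is synthesis from a Floquet vector,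
    that is analysis. *)
Definition bloch (th : R * R) (X : 'M[R[i]]_3) (n : Z2) : R[i] :=
  character th (- n) * X (residue n).1 (residue n).2.

Lemma schrodinger_bloch th X mu : symbol_op l%:C (cis th.1) (cis th.2) X = mu *: X ->
  schrodinger l mu (bloch th X) = 0.
Proof.
move=> /matrixP XE; apply/funext => n; set j := (residue n).1; set k := (residue n).2.
have := XE j k.
have mD (A B : 'M[R[i]]_3) : (A + B) j k = A j k + B j k by rewrite mxE.
have mZ c (A : 'M[R[i]]_3) : (c *: A) j k = c * A j k by rewrite mxE.
rewrite /symbol_op mD !mZ hop_conjugate_sum => h.
have sE m : (line_sign R m)%:C = site_sign R[i] (m%:~R : 'Z_3).
  by rewrite /line_sign /site_sign; case: ifP => _; rewrite ?rmorphN rmorph1.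
have SE : (sgnmx R[i] *m X *m sgnmx R[i]) j k = (gap_potential R n)%:C * X j k.
  rewrite mul_mx_diag mxE mul_diag_mx !mxE /gap_potential rmorphM /= !sE.
  by rewrite /j /k; move: (X _ _) => x; rewrite mulrAC.
rewrite SE in h.
have -> : schrodinger l mu (bloch th X) n = character th (- n) *
  (\sum_(d <- 0 :: ehm_offsets)
    character th (- d) * X (j + (residue d).1) (k + (residue d).2) +
    l%:C * ((gap_potential R n)%:C * X j k) - mu * X j k).
  rewrite /schrodinger mulrBr mulrDr mulr_sumr.
  rewrite -[bloch th X n]/(character th (- n) * X j k).
  rewrite [(l * _)%:C]rmorphM /=; move: (gap_potential R n)%:C => v.
  congr (_ + _ - _); [|ring|ring].
  apply: eq_bigr => d _; rewrite /bloch opprD characterD residueD mulrA; congr (_ * X _ _).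
by rewrite h subrr mulr0.
Qed.

Lemma bloch_norm th X n : normc (bloch th X n) <= \sum_j \sum_k normc (X j k).
Proof.
rewrite /bloch normcM.
have -> : normc (character th (- n)) = 1.
  by apply: complexI; rewrite -[LHS]/`|character th (- n)| character_norm.
rewrite mul1r (bigD1 (residue n).1)//= (bigD1 (residue n).2)//= -addrA lerDl.
by rewrite addr_ge0// ?sumr_ge0// => *; rewrite ?sumr_ge0// => *; exact: normc_ge0.
Qed.

(* Weights at neighbouring sites differ at most by a factor [r ^ 2], so the
   damped Bloch wave is an approximate eigenfunction as [r] tends to 1. *)
Lemma weighted_schrodinger (r : R) mu (u : Z2 -> R[i]) n : 0 < r -> r <= 1 ->
  schrodinger l mu u = 0 ->
  normc (schrodinger l mu (fun m => (r ^+ dist1 m)%:C * u m) n) <=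
  (r ^- 2 - 1) * \sum_(d <- 0 :: ehm_offsets) normc ((r ^+ dist1 (n + d))%:C * u (n + d)).
Proof.
move=> r0 r1 /(congr1 (fun f => f n)) u0; rewrite -[RHS]/(0) in u0.
have -> : schrodinger l mu (fun m => (r ^+ dist1 m)%:C * u m) n =
    \sum_(d <- 0 :: ehm_offsets) (r ^+ dist1 (n + d) - r ^+ dist1 n)%:C * u (n + d).
  transitivity (schrodinger l mu (fun m => (r ^+ dist1 m)%:C * u m) n -
    (r ^+ dist1 n)%:C * schrodinger l mu u n); first by rewrite u0 mulr0 subr0.
  rewrite /schrodinger mulrBr mulrDr mulr_sumr.
  under [RHS]eq_bigr do rewrite rmorphB mulrBl.
  rewrite sumrB; move: (\sum_(d <- _) _) (\sum_(d <- _) _) (_%:C) => a b c; ring.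
have cn (c : R[i]) : `|c| = (normc c)%:C by [].
rewrite -lecR -cn; apply: le_trans (ler_norm_sum _ _ _) _.
rewrite mulr_sumr rmorph_sum /= big_seq [leRHS]big_seq.
apply: ler_sum => d dO; rewrite cn lecR !normcM !normc_real mulrA.
rewrite ler_wpM2r ?normc_ge0//.
rewrite [X in _ <= _ * X]ger0_norm ?exprn_ge0 ?(ltW r0)//.
have := mem_offsets_le1 dO => /andP[d1 d2].
by apply: pow_ratio => //; rewrite /dist1; case: (n) => a b; case: (d) d1 d2 => c e /=; lia.
Qed.

End Weyl.

Section Spectrum.
Variables (R : realType) (l : R).
Local Notation Z2 := (int * int)%type.
Local Notation H := (ell2 R Z2).

Lemma gap_op_weight_le mu (u : Z2 -> R[i]) (r : R) (psi : H) : 0 < r -> r <= 1 ->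
  schrodinger l (mu + 1) u = 0 ->
  (forall n, psi n = (r ^+ dist1 n)%:C * u n) ->
  rnorm (gap_op l psi - mu *: psi) <= (r ^- 2 - 1) * 9 * rnorm psi.
Proof.
move=> r0 r1 u0 psiE.
have nl2 : (fun n => (normc (psi n))%:C) \in @square_summable R _.
  apply/square_summableP; apply: le_lt_trans (_ : (1 ^+ 2)%:E * ell2_mass psi < +oo)%E.
    by apply: ell2_mass_le => n; rewrite normc_real mul1r ger0_norm// normc_ge0.
  by rewrite expr1n mul1e; exact/square_summableP/ell2_funP.
(* Passing to |psi| makes the pointwise bound of [weighted_schrodinger] a sum of nine shifts of one
   element of [ell2], of norm at most 9 times that of [psi]. *)
pose phi : H := Ell2 nl2.
have phi_psi : rnorm phi <= rnorm psi.
  rewrite -[leRHS]mul1r; apply: rnorm_le => //; apply: ell2_mass_le => n.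
  by rewrite normc_real mul1r ger0_norm// normc_ge0.
have c0 : 0 <= r ^- 2 - 1.
  by rewrite subr_ge0 invf_ge1 ?exprn_gt0// exprn_ile1// ltW.
pose s : H := \sum_(d <- 0 :: ehm_offsets) Ell2 (shift_ell2 phi d).
rewrite -mulrA; apply: le_trans (_ : (r ^- 2 - 1) * rnorm s <= _).
  apply: rnorm_le => //; apply: ell2_mass_le => n.
  have psif : ell2_fun psi = (fun m => (r ^+ dist1 m)%:C * u m) by exact/funext.
  rewrite gap_op_fun psif; apply: le_trans (weighted_schrodinger _ r0 r1 u0) _.
  rewrite ler_wpM2l// ell2_fun_sum.
  have -> : \sum_(d <- 0 :: ehm_offsets) Ell2 (shift_ell2 phi d) n =
     (\sum_(d <- 0 :: ehm_offsets) normc (psi (n + d)))%:C.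
    by rewrite rmorph_sum.
  rewrite normc_real ger0_norm; last by rewrite sumr_ge0// => d _; exact: normc_ge0.
  by apply: ler_sum => d _; rewrite psiE.
rewrite ler_wpM2l//; apply: le_trans (rnorm_sum _ _) _.
rewrite (eq_bigr (fun=> rnorm phi)) => [|d _]; last exact: rnorm_shift.
apply: le_trans (_ : 9 * rnorm phi <= _); last by rewrite ler_wpM2l.
by rewrite big_const_seq /= addr0 mulr_natl !mulrS addr0.
Qed.

Lemma resolvent_lower_bound E : resolvent_set (gap_op l : H -> H) E ->
  exists2 C : R, 0 < C & forall psi : H, rnorm psi <= C * rnorm (gap_op l psi - E *: psi).
Proof.
case=> B [Bc BK _].
have /linear_boundedP[C [Cr CB]] : bounded_near B (nbhs (0 : H)).
  by apply: continuous_linear_bounded; exact: Bc.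
have /complex_realP[c cE] := Cr.
exists (Num.max c 0 + 1) => [|psi].
  by rewrite ltr_pwDr// le_max lexx orbT.
rewrite -{1}[psi]BK -lecR rmorphM -!rnormE; apply: CB; rewrite cE ltcR.
by rewrite ltr_pwDr// le_max lexx.
Qed.

Lemma floquet_in_spectrum E th : floquet l th - (E + 1)%:M \notin unitmx ->
  spectrum (gap_op l : H -> H) E.
Proof.
move=> /not_unitmx_eigenvector[v v0 vE] /resolvent_lower_bound[C C0 lowC].
pose X := vec_mx v.
have XE : symbol_op l%:C (cis th.1) (cis th.2) X = (E + 1) *: X.
  apply: (can_inj mxvecK); rewrite -mxvec_symbol linearZ /= vec_mxK.
  exact: vE.
have [j [k Xjk]] : exists j k, X j k != 0.
  apply: contrapT => X0; move/eqP: v0; apply; rewrite -[v]vec_mxK -/X.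
  have -> : X = 0; last by rewrite linear0.
  apply/matrixP => j k; rewrite [RHS]mxE; apply/eqP/negPn/negP => h; apply: X0.
  exists j, k; exact: h.
pose u := bloch th X.
have u0 := schrodinger_bloch XE.
(* A site in the residue class of a nonzero entry of [X]; there the damped wave does not vanish. *)
pose n0 : Z2 := ((j : nat)%:Z, (k : nat)%:Z).
have res (i : 'I_3) : ((i : nat)%:Z%:~R : 'Z_3) = i by rewrite -pmulrn natr_Zp.
have un0 : u n0 != 0.
  rewrite /u /bloch /n0 mulf_neq0//; first exact: cis_neq0.
  by rewrite /residue /= !res.
have [r [r0 r1 rC]] : exists r : R, [/\ 0 < r, r < 1 & C * ((r ^- 2 - 1) * 9) < 1].
  (* With r^-2 = 1 + e the product to be bounded is 9 C e = 1/2. *)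
  pose e := (18 * C)^-1; have e0 : 0 < e by rewrite invr_gt0 mulr_gt0.
  pose s := (1 + e)^-1.
  have s0 : 0 < s by rewrite invr_gt0 addr_gt0.
  have s1 : s < 1 by rewrite invf_lt1 ?addr_gt0// ltrDl.
  exists (Num.sqrt s); split; first by rewrite sqrtr_gt0.
    by rewrite -sqrtr1 ltr_sqrt.
  rewrite sqr_sqrtr ?(ltW s0)// invrK addrAC subrr add0r.
  have : e * (18 * C) = 1 by rewrite mulVf// gt_eqF// mulr_gt0.
  lra.
pose psi : H := Ell2 (weight_ell2 r0 r1 (bloch_norm th X)).
have h1 := gap_op_weight_le r0 (ltW r1) u0 (fun n => erefl : psi n = _).
have psi0 : 0 < rnorm psi.
  apply: lt_le_trans (normc_le_rnorm psi n0).
  rewrite normcM mulr_gt0//; last first.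
    rewrite lt_neqAle normc_ge0 andbT eq_sym; apply: contra un0 => /eqP.
    by move=> /eq0_normc h; apply/eqP; exact: h.
  by rewrite normc_real gtr0_norm exprn_gt0.
have := lowC psi; apply/negP; rewrite -ltNge.
apply: le_lt_trans (ler_wpM2l (ltW C0) h1) _.
by rewrite mulrA gtr_pMl.
Qed.

End Spectrum.

(** * Connected components *)

Section TwoComponents.
Variable T : topologicalType.
Implicit Types A B C : set T.

Lemma component_of_separated B C x : B x -> connected B -> separated B C ->
  connected_component (B `|` C) x = B.
Proof.
move=> Bx cB sBC; apply/seteqP; split.
  have := connected_subset sBC (@connected_component_sub _ _ x)
    (@component_connected _ (B `|` C) x).
  case=> // sub; have : (B `&` closure C) x.
    split=> //; apply/subset_closure/sub/connected_component_refl; by left.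
  by rewrite sBC.2.
by apply: connected_component_max => //; exact: subsetUl.
Qed.

Lemma separated_sym B C : separated B C -> separated C B.
Proof. by case=> h1 h2; split; rewrite setIC. Qed.

Lemma components_of_separated B C : B !=set0 -> C !=set0 ->
  connected B -> connected C -> separated B C ->
  (connected_components (B `|` C) #= `I_2)%card.
Proof.
move=> [b Bb] [c Cc] cB cC sBC.
have compB x : B x -> connected_component (B `|` C) x = B.
  by move=> Bx; exact: component_of_separated.
have compC x : C x -> connected_component (B `|` C) x = C.
  by move=> Cx; rewrite setUC; apply: component_of_separated => //; exact: separated_sym.
have BC : B <> C.
  move=> BC; have : (B `&` closure C) b by split=> //; apply: subset_closure; rewrite -BC.
  by rewrite sBC.2.
have -> : connected_components (B `|` C) = (fun i => if i == 0 then B else C) @` `I_2.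
  apply/seteqP; split=> [_ [x [Bx|Cx] <-]|_ [i _ <-]].
  - by exists 0%N => //; rewrite compB.
  - by exists 1%N => //; rewrite compC.
  - case: ifP => _; first by exists b; [left|exact: compB].
    by exists c; [right|exact: compC].
apply: inj_card_eq => -[|[|i]] [|[|j]]; rewrite ?inE //= => _ _.
by move=> CB; case: BC.
Qed.

End TwoComponents.

(** * The spectrum as a subset of the real line *)

Section RealSpectrum.
Variables (R : realType) (l : R).
Local Notation Z2 := (int * int)%type.
Local Notation H := (ell2 R Z2).

Definition energy (mu : R) : R[i]^o := (mu - 1)%:C.

Lemma energyE mu : (energy mu : R[i]) + 1 = mu%:C.
Proof. by rewrite /energy rmorphB rmorph1 subrK. Qed.

Lemma energy_dist mu nu : `|energy mu - energy nu| = `|mu - nu|%:C.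
Proof.
by rewrite -rmorphB -[LHS]/((normc _)%:C) normc_real opprB addrA subrK.
Qed.

Lemma energy_continuous : continuous energy.
Proof.
move=> x; apply/cvgrPdist_lt => e e0.
have /complex_realP[a aE] : e \is Num.real by exact: gtr0_real.
have a0 : 0 < a by rewrite -ltcR -aE.
near=> y; rewrite energy_dist aE ltcR; near: y.
by apply: (@cvgr_dist_lt _ _ _ _ _ id x) => //; exact: cvg_id.
Unshelve. all: by end_near. Qed.

(** For [s] and [s'] of opposite signs |s'| <= |s' - s|, so the ball of radius |s'| around the
    energy of [s'] misses the other set. *)
Lemma separated_energy (A B : set R) : (forall x, A x -> x < 0) ->
  (forall x, B x -> 0 < x) -> separated (energy @` A) (energy @` B).
Proof.
move=> A0 B0.
have far (S S' : set R) : (forall s s', S s -> S' s' -> `|s'| <= `|s' - s|) ->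
  (forall s, S' s -> s != 0) -> closure (energy @` S) `&` energy @` S' = set0.
  move=> SS' S'0; apply/seteqP; split=> // y [cl [s S's sy]]; move: cl; rewrite -{}sy.
  have s0 : 0 < `|s|%:C by rewrite ltcR normr_gt0 S'0.
  move=> /(_ _ (nbhsx_ballx (energy s) _ s0))[_ [ [t St <-] near_t]]; move: near_t.
  by rewrite /ball /= energy_dist ltcR ltNge SS'.
split; first apply: far => [s t As Bt|s /B0 /gt_eqF ->//].
  have := A0 s As; have := B0 t Bt; move=> t0 s0.
  by rewrite !gtr0_norm ?subr_gt0 ?(lt_trans s0 t0)// lerDl oppr_ge0 ltW.
rewrite setIC; apply: far => [s t Bs At|s /A0 /lt_eqF ->//].
have := A0 t At; have := B0 s Bs; move=> s0 t0.
by rewrite !ltr0_norm ?subr_lt0 ?(lt_trans t0 s0)// opprB lerBrDr addrC subrr ltW.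
Qed.

(** A spectral value is complex a priori; it is real because [E + 1] is an eigenvalue of a Hermitian
    Floquet matrix. *)
Lemma spectrum_gap_op :
  spectrum (gap_op l : H -> H) = energy @` floquet_spectrum l.
Proof.
apply/seteqP; split=> [E specE|_ [mu [th nu] <-]]; last first.
  by apply: (@floquet_in_spectrum _ _ _ th); rewrite energyE.
have [th nu] : exists th, floquet l th - (E + 1)%:M \notin unitmx.
  apply: contrapT => h; apply: specE; apply: gap_op_resolvent => th.
  by apply/negP/negP; apply: contra_notT h => h; exists th.
have [v v0 vE] := not_unitmx_eigenvector nu.
have /complex_realP[mu muE] := herm_eigenvalue_real (floquet_herm l th) v0 vE.
exists mu; last by apply: (addIr (1 : R[i])); rewrite energyE -muE.
by exists th; rewrite -muE.
Qed.

Lemma spectrum_components : 0 < l -> l <= 4 / 9 ->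
  (connected_components (spectrum (gap_op l : H -> H)) #= `I_2)%card.
Proof.
move=> l0 l49; pose S := floquet_spectrum l.
pose N := S `&` [set mu | mu < 0]; pose P := S `&` [set mu | 0 < mu].
have -> : spectrum (gap_op l : H -> H) = energy @` N `|` energy @` P.
  rewrite spectrum_gap_op -image_setU -setIUr; congr (_ @` _).
  apply/seteqP; split=> [mu Smu|mu []//]; split=> //=.
  case: (ltrgt0P mu) => mu0; [by right|by left|].
  by exfalso; apply: (floquet_spectrum0 l0 l49); rewrite -mu0.
have within_energy A : {within A, continuous energy}.
  by apply: continuous_subspaceT; exact: energy_continuous.
apply: components_of_separated.
- by exists (energy (-1)), (-1) => //; split; [exact: floquet_spectrumN1|exact: ltrN10].
- by exists (energy 5), 5 => //; split; [exact: floquet_spectrum5|exact: ltr0n].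
- apply: connected_continuous_connected => //; apply/connected_intervalP.
  move=> x y [Sx x0] [Sy y0] z /andP[]; rewrite le_eqVlt => /predU1P[<- //|xz].
  rewrite le_eqVlt => /predU1P[-> //|zy].
  split; last exact: lt_trans zy y0.
  exact: (floquet_spectrum_neg_interval l0 l49 Sx Sy y0 xz zy).
- apply: connected_continuous_connected => //; apply/connected_intervalP.
  move=> x y [Sx x0] [Sy y0] z /andP[]; rewrite le_eqVlt => /predU1P[<- //|xz].
  rewrite le_eqVlt => /predU1P[-> //|zy].
  split; last exact: lt_trans x0 xz.
  exact: (floquet_spectrum_pos_interval l0 l49 Sx Sy x0 xz zy).
- by apply: separated_energy => x [].
Qed.

Lemma gap_potential_periodic : periodic2 3 3 (@gap_potential R).
Proof.
have P m : line_sign R (m + 3%:Z) = line_sign R m.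
  by rewrite /line_sign mulrzDr -[1 *~ 3%:Z]pmulrn pchar_Zp ?addr0.
by move=> n m; rewrite /gap_potential /= !P.
Qed.

End RealSpectrum.

Theorem theorem1p6 (R : realType) :
  exists Q : int * int -> R, periodic2 3 3 Q /\
    \forall l \near (0 : R)^'+,
      (connected_components
        (spectrum (fun psi : ell2 R (int * int)%type =>
           (ehm_laplacian psi + l%:C *: potential Q psi)%R)) #= `I_2)%card.
Proof.
exists (@gap_potential R); split; first exact: gap_potential_periodic.
near=> l; apply: (@spectrum_components R l).
  by near: l; exact: nbhs_right_gt.
by near: l; apply: nbhs_right_le; rewrite divr_gt0.
Unshelve. all: by end_near. Qed.
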